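(* The $n$-dimensional complex sphere $SO(n+1,\mathbb{C})/SO(n,\mathbb{C})$ admits a compact Clifford-Klein form if $n=1$, $3$ or $7$.
   Context: For $G$ a Lie group and $H$ a closed subgroup, if $\Gamma$ is a discrete subgroup of $G$ acting properly discontinuously and freely on $G/H$, the manifold $\Gamma\backslash G/H$ is called a Clifford-Klein form of $G/H$. $G/H$ admits a compact Clifford-Klein form if such a $\Gamma$ exists with $\Gamma\backslash G/H$ compact. The $n$-dimensional complex sphere is $S^n_{\mathbb{C}}=\{(z_1,\dots,z_{n+1})\in\mathbb{C}^{n+1}: z_1^2+\dots+z_{n+1}^2=1\}$, which is biholomorphic to $SO(n+1,\mathbb{C})/SO(n,\mathbb{C})$; Clifford-Klein forms are taken with respect to $G=SO(n+1,\mathbb{C})$, $H=SO(n,\mathbb{C})$. *)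

(* Defs.v *)
From HB Require Import structures.
From mathcomp Require Import all_boot all_order all_algebra.
From mathcomp Require Import all_classical all_reals all_analysis.
From mathcomp.real_closed Require Export complex.

Set Implicit Arguments.
Unset Strict Implicit.
Unset Printing Implicit Defensive.

Import GRing.Theory Num.Theory.
Import numFieldNormedType.Exports.

Local Open Scope classical_set_scope.
Local Open Scope quotient_scope.

HB.mixin Record Group_isTopologicalGroup G of Group G & Topological G := {
  mulg_continuous : continuous (fun p : G * G => (p.1 * p.2)%g);
  invg_continuous : continuous (fun x : G => (x^-1)%g)
}.

#[short(type="topologicalGroupType")]
HB.structure Definition TopologicalGroup :=
  {G of Group G & Topological G & Group_isTopologicalGroup G}.

HB.mixin Record isTopClosed (T : topologicalType) (S : {pred T}) := {
  pred_closed : closed [set x | x \in S]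
}.

#[short(type="closedSubgroup")]
HB.structure Definition ClosedSubgroup (G : topologicalGroupType) :=
  {S of GroupClosed G S & isTopClosed G S}.

Section HomogeneousSpace.
Variables (G : topologicalGroupType) (H : groupClosed G).
Local Open Scope group_scope.

Definition coset_rel : rel G := fun x y => x^-1 * y \in H.

Lemma coset_rel_equiv : equiv_class_of coset_rel.
Proof.
rewrite /coset_rel; split=> [x|x y|y x z].
- by rewrite mulVg gpred1.
- by rewrite -[in RHS]gpredV invgM invgK.
- move=> xy yz; suff -> : x^-1 * z = (x^-1 * y) * (y^-1 * z) by exact: gpredM.
  by rewrite -mulgA mulVKg.
Qed.

Canonical coset_equiv := EquivRelPack coset_rel_equiv.

(* G/H *)
Definition homogeneous_space := quotient_topology {eq_quot coset_rel}.

HB.instance Definition _ := Topological.on homogeneous_space.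
HB.instance Definition _ := Quotient.on homogeneous_space.

(* g(xH) = (gx)H; [translateE] shows that this does not depend on the
   representative chosen by [repr]. *)
Definition translate (g : G) (x : homogeneous_space) : homogeneous_space :=
  \pi_homogeneous_space (g * repr x).

Lemma coset_eqP (x y : G) :
  reflect (\pi_homogeneous_space x = \pi_homogeneous_space y) (x^-1 * y \in H).
Proof.
exact: (@eqquotP _ coset_equiv {eq_quot coset_rel} x y).
Qed.

Lemma translateE (g x : G) :
  translate g (\pi_homogeneous_space x) = \pi_homogeneous_space (g * x).
Proof.
apply/coset_eqP; rewrite invgM -mulgA mulKg.
by apply/coset_eqP; rewrite reprK.
Qed.

Lemma translate1 x : translate 1 x = x.
Proof. by rewrite -[x]reprK translateE mul1g. Qed.

Lemma translateM g h x : translate (g * h) x = translate g (translate h x).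
Proof. by rewrite -[x]reprK (translateE h) !translateE mulgA. Qed.

End HomogeneousSpace.

Section CliffordKlein.
Variables (G : topologicalGroupType) (H Gamma : groupClosed G).
Local Open Scope group_scope.

Definition orbit_rel : rel (homogeneous_space H) :=
  fun x y => `[< exists2 g, g \in Gamma & translate g x = y >].

Lemma orbit_rel_equiv : equiv_class_of orbit_rel.
Proof.
split=> [x|x y|y x z].
- by apply/asboolP; exists 1; [exact: gpred1|exact: translate1].
- apply/asboolP/asboolP => -[g gG <-]; exists g^-1; rewrite ?gpredV//;
  by rewrite -translateM mulVg translate1.
- move=> /asboolP[g gG <-] /asboolP[h hG <-]; apply/asboolP.
  by exists (h * g); [exact: gpredM|exact: translateM].
Qed.

Canonical orbit_equiv := EquivRelPack orbit_rel_equiv.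

(* Gamma\G/H, as the quotient of G/H by the left action of Gamma *)
Definition clifford_klein_space := quotient_topology {eq_quot orbit_rel}.

HB.instance Definition _ := Topological.on clifford_klein_space.
HB.instance Definition _ := Quotient.on clifford_klein_space.

Definition discrete_subgroup : Prop :=
  [set x | x \in Gamma] `<=` isolated [set x | x \in Gamma].

Definition properly_discontinuous : Prop :=
  forall S : set (homogeneous_space H), compact S ->
    finite_set [set g | g \in Gamma /\ (translate g @` S) `&` S !=set0].

Definition acts_freely : Prop :=
  forall g (x : homogeneous_space H), g \in Gamma -> translate g x = x -> g = 1.

End CliffordKlein.

Definition admits_compact_clifford_klein_form
    (G : topologicalGroupType) (H : closedSubgroup G) : Prop :=
  exists Gamma : groupClosed G,
    [/\ discrete_subgroup Gamma,
        properly_discontinuous H Gamma,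
        acts_freely H Gamma &
        compact [set: clifford_klein_space H Gamma]].

Section MatrixContinuity.
Local Open Scope ring_scope.

Lemma continuous_mx (X T : topologicalType) m n (f : X -> 'M[T]_(m, n)) :
  (forall i j, continuous (fun x => f x i j)) -> continuous f.
Proof.
move=> cf x U [P Pf PU].
apply: (@filterS _ _ _ (fun y => forall i j, P i j (f y i j))).
  by move=> y Py; exact: PU.
apply: filter_forall => i; apply: filter_forall => j.
exact: cf (Pf i j).
Qed.

Lemma coord_mx_continuous (T : topologicalType) m n i j :
  continuous (fun A : 'M[T]_(m, n) => A i j).
Proof.
move=> A U AU; exists (fun i' j' => [set x | i' = i -> j' = j -> U x]).
  move=> i' j'; have [->|ni] := eqVneq i' i; last first.
    by apply: filterS filterT => x _ /eqP; rewrite (negPf ni).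
  have [->|nj] := eqVneq j' j; last first.
    by apply: filterS filterT => x _ _ /eqP; rewrite (negPf nj).
  by apply: filterS AU => x Ux _ _.
by move=> B BU; exact: (BU i j erefl erefl).
Qed.

End MatrixContinuity.

Section SpecialOrthogonal.
Variable K : numClosedFieldType.
Local Open Scope ring_scope.

(* [A^T] is the plain transpose, without conjugation. *)
Definition SO (n : nat) : Type :=
  [set A : 'M[K]_n | A *m A^T = 1%:M /\ \det A = 1].

HB.instance Definition _ n := Topological.on (SO n).

Definition SO_val n (A : SO n) : 'M[K]_n := set_val A.

Lemma SO_val_inj n : injective (@SO_val n).
Proof. exact: val_inj. Qed.

Lemma SO_trmxr n (A : SO n) : SO_val A *m (SO_val A)^T = 1%:M.
Proof. by have [] := set_valP A. Qed.

Lemma SO_trmxl n (A : SO n) : (SO_val A)^T *m SO_val A = 1%:M.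
Proof. exact/mulmx1C/SO_trmxr. Qed.

Lemma SO_det n (A : SO n) : \det (SO_val A) = 1.
Proof. by have [] := set_valP A. Qed.

Fact SO_one_subproof n :
  1%:M *m 1%:M^T = 1%:M :> 'M[K]_n /\ \det (1%:M : 'M[K]_n) = 1.
Proof. by rewrite trmx1 mulmx1 det1. Qed.

Fact SO_inv_subproof n (A : SO n) :
  (SO_val A)^T *m (SO_val A)^T^T = 1%:M /\ \det (SO_val A)^T = 1.
Proof. by rewrite trmxK det_tr SO_det SO_trmxl. Qed.

Fact SO_mul_subproof n (A B : SO n) :
  (SO_val A *m SO_val B) *m (SO_val A *m SO_val B)^T = 1%:M /\
  \det (SO_val A *m SO_val B) = 1.
Proof.
rewrite det_mulmx !SO_det mulr1 trmx_mul; split=> //.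
by rewrite mulmxA -(mulmxA (SO_val A)) SO_trmxr mulmx1 SO_trmxr.
Qed.

Definition SO_one n : SO n := exist _ 1%:M (mem_set (SO_one_subproof n)).

Definition SO_inv n (A : SO n) : SO n :=
  exist _ (SO_val A)^T (mem_set (SO_inv_subproof A)).

Definition SO_mul n (A B : SO n) : SO n :=
  exist _ (SO_val A *m SO_val B) (mem_set (SO_mul_subproof A B)).

Fact SO_mulA n : associative (@SO_mul n).
Proof. by move=> A B C; apply: SO_val_inj; exact: mulmxA. Qed.

Fact SO_mul1 n : left_id (@SO_one n) (@SO_mul n).
Proof. by move=> A; apply: SO_val_inj; exact: mul1mx. Qed.

Fact SO_mulr1 n : right_id (@SO_one n) (@SO_mul n).
Proof. by move=> A; apply: SO_val_inj; exact: mulmx1. Qed.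

Fact SO_mulV n : left_inverse (@SO_one n) (@SO_inv n) (@SO_mul n).
Proof. by move=> A; apply: SO_val_inj; exact: SO_trmxl. Qed.

Fact SO_mulrV n : right_inverse (@SO_one n) (@SO_inv n) (@SO_mul n).
Proof. by move=> A; apply: SO_val_inj; exact: SO_trmxr. Qed.

HB.instance Definition _ n := isGroup.Build (SO n)
  (@SO_mulA n) (@SO_mul1 n) (@SO_mulr1 n) (@SO_mulV n) (@SO_mulrV n).

Lemma SO_val_continuous n : continuous (@SO_val n).
Proof. exact: initial_continuous. Qed.

Lemma continuous_to_SO (X : topologicalType) n (f : X -> SO n) :
  continuous (fun x => SO_val (f x)) -> continuous f.
Proof. by move=> cf; apply: continuous_comp_initial. Qed.

Lemma SO_coord_continuous n i j : continuous (fun A : SO n => SO_val A i j).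
Proof.
move=> A; apply: (@continuous_comp _ _ _ (@SO_val n) (fun B => B i j)).
  exact: SO_val_continuous.
exact: coord_mx_continuous.
Qed.

Fact SO_mul_continuous n :
  continuous (fun p : SO n * SO n => (p.1 * p.2)%g : SO n).
Proof.
pose f (p : SO n * SO n) := (p.1 * p.2)%g.
apply: (continuous_to_SO (f := f)); apply: continuous_mx => i j p.
rewrite (_ : (fun x => _) = fun q : SO n * SO n =>
  \sum_k SO_val q.1 i k * SO_val q.2 k j); last first.
  by apply/funext => q; rewrite mxE.
apply: cvg_big => [|k _]; first exact: add_continuous.
 apply: cvgM.
  apply: (@continuous_comp _ _ _ fst (fun A : SO n => SO_val A i k)); first exact: cvg_fst.
  exact: SO_coord_continuous.
apply: (@continuous_comp _ _ _ snd (fun A : SO n => SO_val A k j)); first exact: cvg_snd.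
exact: SO_coord_continuous.
Qed.

Fact SO_inv_continuous n : continuous (fun A : SO n => (A^-1)%g : SO n).
Proof.
pose f (A : SO n) := (A^-1)%g.
apply: (continuous_to_SO (f := f)); apply: continuous_mx => i j A.
rewrite (_ : (fun x => _) = fun B : SO n => SO_val B j i).
  exact: SO_coord_continuous.
by apply/funext => B; rewrite mxE.
Qed.

HB.instance Definition _ n := Group_isTopologicalGroup.Build (SO n)
  (@SO_mul_continuous n) (@SO_inv_continuous n).

(* SO(n) embedded in SO(n+1) by A |-> diag(1, A), that is, the stabilizer of
   the first basis vector (a point of the complex sphere). *)
Definition SO_sub (n : nat) : {pred SO n.+1} :=
  fun g => `[< exists A : SO n, SO_val g = lift0_mx (SO_val A) >].

Arguments SO_sub : clear implicits.

Lemma SO_subP n (g : SO n.+1) :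
  reflect (exists A : SO n, SO_val g = lift0_mx (SO_val A)) (g \in SO_sub n).
Proof. exact: asboolP. Qed.

Lemma lift0_mx_row0 n (A : 'M[K]_n) (i : 'I_(1 + n)) :
  let o := @lshift 1 n ord0 in
  lift0_mx A o i = (o == i)%:R /\ lift0_mx A i o = (i == o)%:R.
Proof.
rewrite /lift0_mx; case: (split_ordP i) => k ->.
  by rewrite !block_mxEul !ord1 !mxE.
by rewrite block_mxEur block_mxEdl !mxE eq_lrshift eq_rlshift.
Qed.

Lemma SO_subE n (g : SO n.+1) :
  g \in SO_sub n <->
  forall i, SO_val g ord0 i = (ord0 == i)%:R /\ SO_val g i ord0 = (i == ord0)%:R.
Proof.
split=> [/SO_subP[A gA] i|gE].
  have -> : ord0 = @lshift 1 n ord0 :> 'I_n.+1 by exact: val_inj.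
  by rewrite gA; exact: lift0_mx_row0.
pose B : 'M[K]_(1 + n) := SO_val g.
pose A : 'M[K]_n := drsubmx B.
have BE : B = lift0_mx A.
  have E0 : @lshift 1 n ord0 = ord0 by exact: val_inj.
  rewrite -[LHS]submxK; congr block_mx; apply/matrixP => i j;
    rewrite !mxE ?(ord1 i) ?(ord1 j) E0.
  - by have [-> _] := gE ord0.
  - by have [-> _] := gE (@rshift 1 n j).
  - by have [_ ->] := gE (@rshift 1 n i).
have detA : \det A = 1.
  suff <- : \det B = \det A by exact: SO_det.
  by rewrite BE /lift0_mx (@det_lblock _ 1 n) det1 mul1r.
have orthA : A *m A^T = 1%:M.
  have : B *m B^T = 1%:M by exact: SO_trmxr.
  rewrite BE /lift0_mx tr_block_mx !trmx0 mulmx_block.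
  rewrite !mul0mx !add0r (@scalar_mx_block _ 1 n) => /(@eq_block_mx _ 1 n 1 n).
  by case.
apply/SO_subP; exists (exist _ A (mem_set (conj orthA detA))); exact: BE.
Qed.

Lemma lift0_mxM n (A B : 'M[K]_n) :
  lift0_mx A *m lift0_mx B = lift0_mx (A *m B).
Proof.
by rewrite /lift0_mx mulmx_block !(mulmx0, mul0mx) mulmx1 !(addr0, add0r).
Qed.

Lemma lift0_mx_tr n (A : 'M[K]_n) : (lift0_mx A)^T = lift0_mx A^T.
Proof. by rewrite /lift0_mx tr_block_mx !trmx0 trmx1. Qed.

Fact SO_sub_group_closed n : group_closed (SO_sub n).
Proof.
split=> [|g h /SO_subP[A gA] /SO_subP[B hB]]; apply/SO_subP.
  by exists 1%g; exact: (@scalar_mx_block _ 1 n 1).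
exists (A / B)%g; rewrite [LHS](_ : _ = SO_val g *m (SO_val h)^T)//.
rewrite gA hB; apply: etrans (lift0_mxM _ _).
by congr mulmx; exact: lift0_mx_tr.
Qed.

Fact SO_sub_closed n : closed [set g | g \in SO_sub n].
Proof.
have clE i j (c : K) : closed [set g : SO n.+1 | SO_val g i j = c].
  apply: (@preimage_closed _ _ (fun g => SO_val g i j) [set c]).
    by move=> g _; exact: SO_coord_continuous.
  exact/accessible_closed_set1/hausdorff_accessible/norm_hausdorff.
rewrite (_ : mkset _ = \bigcap_i
  ([set g : SO n.+1 | SO_val g ord0 i = (ord0 == i)%:R] `&`
   [set g | SO_val g i ord0 = (i == ord0)%:R])).
  by apply: closed_bigI => i _; exact: closedI.
by apply/seteqP; split=> g /= => [/SO_subE gE i _|gE];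
  [exact: gE|apply/SO_subE => i; exact: gE].
Qed.

HB.instance Definition _ n := isMulClosed.Build _ (SO_sub n)
  (group_closedM (@SO_sub_group_closed n)).
HB.instance Definition _ n := isMul1Closed.Build _ (SO_sub n)
  (proj1 (@SO_sub_group_closed n)).
HB.instance Definition _ n := isInvClosed.Build _ (SO_sub n)
  (group_closedV (@SO_sub_group_closed n)).
HB.instance Definition _ n := isTopClosed.Build _ (SO_sub n)
  (@SO_sub_closed n).

End SpecialOrthogonal.

Arguments SO : clear implicits.
Arguments SO_sub : clear implicits.

(* Main.v *)
Require Import Defs.
From mathcomp Require Import all_boot all_algebra all_reals.
From HB Require Import structures.
From mathcomp Require Import all_order perm all_classical all_analysis.
From mathcomp Require Import ring lra zify.

(** Put m = n + 1, so that m is 2, 4 or 8. Multiplication by the basis elements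
    of the complex numbers, the quaternions or the octonions gives integer
    m x m matrices L_0 = 1, L_1, ..., L_n with L_j^T L_k + L_k^T L_j = 2 delta_jk.
    Inside the complex orthogonal group O(m, C), the products of the matrices
    c_0 + c_1 L_1 + ... + c_n L_n with c_0 real, the other c_k imaginary and
    sum c_k^2 = 1 form a copy of Spin(1, n); they preserve the tensor
    sum_k L_k (x) L_k, read as a form that is conjugate-linear in its first and
    third arguments ([fierz_comb]).

    This group acts properly on the sphere X = {z | z^T z = 1}. Because there are
    as many L_k as coordinates, the composition identity
    sum_k (z^* L_k z)^2 = |z^T z|^2 holds ([coef_sqr_sum]), so z |-> (z^* L_k z)_k
    is a proper equivariant map from X to hyperbolic n-space. Concretely, an
    explicit element [boost L z] of the group, bounded in terms of z, carries z to
    a real unit vector ([boost_real]), and a matrix which preserves the tensor and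
    maps one real unit vector to another is unitary ([fierz_unitary]). It
    therefore suffices to exhibit a discrete cocompact subgroup that is
    sufficiently deep to act freely.

    The subgroup Gamma is arithmetic. The ring Z[x] / (x^4 - 2) has the complex
    place x |-> i 2^(1/4) and the two real places x |-> +- 2^(1/4). Gamma consists
    of the matrices congruent to 1 modulo 2m over this ring that are orthogonal and
    whose values at the complex place preserve the tensor. The values at the real
    places lie in the compact group O(m, R), and a nonzero element of the ring has
    norm at least 1. Hence Gamma is discrete ([Gamma_separated]) and meets every
    bounded set in a finite set ([Gamma_finite]). An element P with a fixed point on
    X is conjugate to a unitary matrix, so |tr P| <= m at every place; then
    tr ((P - 1)(P - 1)^T) / (2m)^2 is a ring element all of whose conjugates are
    smaller than 1, so it vanishes and P = 1 ([Gamma_free]).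

    Cocompactness ([Gamma_cocompact]) is reduction theory. Each z in X defines a
    Hermitian form on the lattice of integral vectors, of fixed determinant. The
    form v^T v is anisotropic at the real places and has values of norm at least 1,
    so the Hermitian form is bounded below on nonzero lattice vectors, and Hermite's
    reduction ([hermite_reduction]) yields m linearly independent lattice vectors of
    bounded length, the columns of a matrix X. The Gram matrix of X, its determinant,
    its tensor and its residue modulo a suitable integer range over a finite set. If
    z and z' have the same invariants, then X' X^-1 belongs to Gamma and moves z to
    within a bound that depends only on those invariants. *)

Set Implicit Arguments.
Unset Strict Implicit.
Unset Printing Implicit Defensive.

Import Order.TTheory GRing.Theory Num.Theory.
Import numFieldNormedType.Exports.

(** * Hermite reduction of real quadratic forms on integer vectors *)

Section Reduction.
Local Open Scope ring_scope.

(** The Smith normal form of a column has a single entry. *)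
Lemma unimodular_completion k (z : 'cV[int]_k.+1) :
  exists2 L : 'M[int]_k.+1, L \in unitmx & exists t : int, z = t *: col ord0 L.
Proof.
have [L Lu [r ru [d _ zE]]] := int_Smith_normal_form z.
exists L => //; exists (d`_0 * r ord0 ord0).
rewrite zE; apply/matrixP => i j; rewrite (ord1 j) !mxE big_ord1 !mxE.
rewrite (bigD1 ord0) //= big1 => [|l /negPf l0].
  by rewrite addr0 !mxE mulr1n -mulrA mulrC.
by rewrite !mxE [_ == _]l0 mulr0n mulr0.
Qed.

Variable R : realType.

Definition intmx m n (A : 'M[int]_(m, n)) : 'M[R]_(m, n) := map_mx intr A.

Definition qform k (S : 'M[R]_k) (v : 'cV[R]_k) : R := (v^T *m S *m v) ord0 ord0.

Lemma qform_congr k l (S : 'M[R]_k) (L : 'M[R]_(k, l)) v :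
  qform (L^T *m S *m L) v = qform S (L *m v).
Proof. by rewrite /qform trmx_mul !mulmxA. Qed.

Lemma qformZ k (S : 'M[R]_k) t v : qform S (t *: v) = t ^+ 2 * qform S v.
Proof.
by rewrite /qform -scalemxAr [(t *: v)^T]linearZ /= -!scalemxAl scalerA mxE expr2.
Qed.

Lemma qform_delta k (S : 'M[R]_k) i : qform S (delta_mx i ord0) = S i i.
Proof. by rewrite /qform trmx_delta -rowE -colE !mxE. Qed.

Lemma qform_diag k l (S : 'M[R]_k) (L : 'M[R]_(k, l)) i :
  (L^T *m S *m L) i i = qform S (col i L).
Proof. by rewrite -qform_delta qform_congr -colE. Qed.

(** The form induced on the quotient by the first basis vector, when that vector
    has value [a] and pairs with the others as [b]. *)
Definition schur k (a : R) (b : 'rV[R]_k) (S : 'M[R]_k) : 'M[R]_k :=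
  S - a^-1 *: (b^T *m b).

Lemma qform_schur k (a : R) (b : 'rV[R]_k) (S : 'M[R]_k) (x : R) (y : 'cV_k) :
  a != 0 ->
  qform (block_mx a%:M b b^T S : 'M[_]_(1 + k)) (col_mx x%:M y) =
  a * (x + a^-1 * (b *m y) ord0 ord0) ^+ 2 + qform (schur a b S) y.
Proof.
move=> a0; rewrite /qform /schur tr_col_mx mul_row_block mul_row_col.
set t := (b *m y) ord0 ord0.
have bE : b *m y = t%:M by exact: mx11_scalar.
have bE' : y^T *m b^T = t%:M by rewrite -trmx_mul bE tr_scalar_mx.
rewrite tr_scalar_mx -scalar_mxM mul_scalar_mx bE' !mulmxDl -!scalar_mxM.
rewrite -scalemxAl bE mulmxBr mulmxBl -scalemxAr -scalemxAl mulmxA bE'.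
rewrite -[t%:M *m b *m y]mulmxA.
rewrite bE -scalar_mxM !mxE /= !mulr1n.
by set q := \sum_j _; field.
Qed.

Lemma det_schur k (a : R) (b : 'rV[R]_k) (S : 'M[R]_k) : a != 0 ->
  \det (block_mx a%:M b b^T S : 'M[_]_(1 + k)) = a * \det (schur a b S).
Proof.
move=> a0.
have := det_mulmx (block_mx a%:M b b^T S : 'M[_]_(1 + k)) (block_mx 1%:M (- a^-1 *: b) 0 1%:M).
rewrite det_ublock !det1 !mulr1 => <-.
rewrite mulmx_block !mulmx1 !mulmx0 !addr0 mul_scalar_mx scalerA mulrN divff //.
rewrite scaleN1r addNr det_lblock det_scalar1 -scalemxAr addrC scaleNr.
by [].
Qed.

Lemma round_intr (t : R) : exists x : int, (x%:~R + t) ^+ 2 <= 1 / 4.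
Proof.
exists (- Num.floor (t + 1 / 2)).
have /andP[] := floor_itv (t + 1 / 2).
by rewrite intrN intrD; move: (_%:~R) => f h1 h2; nra.
Qed.

(** Hermite's induction: take an almost shortest vector, complete it to a basis of
    the integer lattice, and apply induction to the Schur complement. Size
    reduction shows that the complement is still bounded below, and its
    determinant is divided by the value of the short vector. *)
Lemma hermite_reduction k (c d : R) : 0 < c ->
  exists B, forall S : 'M[R]_k, S^T = S -> \det S <= d ->
    (forall z : 'cV[int]_k, z != 0 -> c <= qform S (intmx z)) ->
  exists2 U : 'M[int]_k, \det U != 0 &
    forall i, qform S (intmx (col i U)) <= B.
Proof.
elim: k c d => [|k IHk] c d c0.
  by exists 0 => S _ _ _; exists 1%:M; rewrite ?det1 // => -[].
have c40 : 0 < c / 4 by lra.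
have [B IH] := IHk (c / 4) (`|d| / c) c40.
exists (`|d| + 5 * `|B|) => S symS detS minS.
pose E := [set qform S (intmx z) | z in [set z : 'cV[int]_k.+1 | z != 0]]%classic.
(* A vector with value below twice the infimum takes the place of a shortest
   vector, whose existence would require a discreteness argument. *)
have Einf : has_inf E.
  split; last by exists c => _ [z /= z0 <-]; exact: minS.
  exists (qform S (intmx (delta_mx ord0 ord0))), (delta_mx ord0 ord0) => //=.
  by apply/eqP => /matrixP/(_ ord0 ord0) /eqP; rewrite !mxE !eqxx.
have c_inf : c <= inf E.
  by apply: lb_le_inf => [|_ [z /= z0 <-]]; [have [] := Einf | exact: minS].
have [_ [z /= z0 <-] z_inf] := inf_adherent (lt_le_trans c0 c_inf) Einf.
have nearmin y : y != 0 -> qform S (intmx z) / 2 < qform S (intmx y).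
  move=> y0; have : inf E <= qform S (intmx y).
    by apply: ge_inf; [have [] := Einf | exists y].
  lra.
have [L Lu [t zE]] := unimodular_completion z.
have y0 : col ord0 L != 0.
  by apply: contraNneq z0 => y0; rewrite zE y0 scaler0.
have qz : qform S (intmx z) = t%:~R ^+ 2 * qform S (intmx (col ord0 L)).
  by rewrite zE /intmx map_mxZ qformZ.
(* The short vector is primitive: dividing it by t with |t| >= 2 would give a
   value below half of its own, hence below the infimum. *)
have t1 : t%:~R ^+ 2 = 1 :> R.
  have t0 : t != 0 by apply: contraNneq z0 => t0; rewrite zE t0 scale0r.
  have := nearmin _ y0; rewrite qz => hy.
  have hpos : 0 < qform S (intmx (col ord0 L)) by apply: lt_le_trans (minS _ y0).
  have t2 : (t ^+ 2)%:~R < 2 :> R by rewrite rmorphXn /=; nra.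
  have {}t2 : t ^+ 2 < 2 by rewrite -(ltr_int R).
  have t3 : 0 < t ^+ 2 by rewrite exprn_even_gt0 ?t0.
  rewrite -rmorphXn /= (_ : t ^+ 2 = 1) //.
  by move: t2 t3; case: (t ^+ 2) => [[|[|[]]]|].
move: qz; rewrite t1 mul1r => qz.
pose S1 := (intmx L)^T *m S *m intmx L.
have qS1 y : qform S1 (intmx y) = qform S (intmx (L *m y)).
  by rewrite qform_congr /intmx map_mxM.
have symS1 : S1^T = S1 by rewrite /S1 !trmx_mul trmxK symS mulmxA.
have detS1 : \det S1 = \det S.
  rewrite /S1 !det_mulmx det_tr /intmx det_map_mx mulrC mulrA -expr2 -rmorphXn /=.
  have : \det L ^+ 2 = 1.
    by move: Lu; rewrite unitmxE qualifE => /orP[] /eqP ->.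
  by move=> ->; rewrite mul1r.
have aE : S1 ord0 ord0 = qform S (intmx (col ord0 L)).
  by rewrite /S1 qform_diag /intmx map_col.
clearbody S1; pose S1' : 'M[_]_(1 + k) := S1.
pose a := S1 ord0 ord0; pose b := ursubmx S1'; pose S2 := drsubmx S1'.
have S1E : S1' = block_mx a%:M b b^T S2.
  rewrite -[LHS]submxK; congr block_mx.
    by apply/matrixP => i j; rewrite !ord1 !mxE eqxx mulr1n; congr (S1 _ _); exact: val_inj.
  by rewrite /b trmx_ursub symS1.
rewrite -/a in aE.
have ca : c <= a by rewrite aE; exact: minS.
have a0 : 0 < a by exact: lt_le_trans ca.
have an0 : a != 0 by rewrite gt_eqF.
have nearmin1 y : y != 0 -> a / 2 < qform S1 (intmx y).
  move=> yn0; rewrite qS1 aE -qz; apply: nearmin.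
  by apply: contraNneq yn0 => Ly; rewrite -[y](mulKmx Lu) Ly mulmx0.
have qblock (x : int) (y : 'cV[int]_k) :
    qform S1 (intmx (col_mx x%:M y)) =
    a * (x%:~R + a^-1 * (b *m intmx y) ord0 ord0) ^+ 2 + qform (schur a b S2) (intmx y).
  rewrite -qform_schur // -S1E /intmx map_col_mx.
  by rewrite map_scalar_mx.
have lift (y : 'cV[int]_k) : exists x : int,
    qform S1 (intmx (col_mx x%:M y)) <= a / 4 + qform (schur a b S2) (intmx y).
  have [x hx] := round_intr (a^-1 * (b *m intmx y) ord0 ord0).
  exists x; rewrite qblock lerD2r; move: hx; set u := _ ^+ 2 => hx; nra.
have minS2 (y : 'cV[int]_k) : y != 0 -> a / 4 <= qform (schur a b S2) (intmx y).
  move=> yn0; have [x] := lift y.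
  have /nearmin1 : col_mx x%:M y != 0 by rewrite col_mx_eq0 negb_and yn0 orbT.
  lra.
have detS2 : \det (schur a b S2) <= `|d| / c.
  have : a * \det (schur a b S2) <= `|d|.
    by rewrite -det_schur // -S1E detS1 (le_trans detS) // ler_norm.
  rewrite ler_pdivlMr //; move: (\det _) => u; have := normr_ge0 d; nra.
have symS2 : (schur a b S2)^T = schur a b S2.
  rewrite /schur linearB linearZ /= trmx_mul trmxK.
  by rewrite /S2 trmx_drsub symS1.
have minS2' (y : 'cV[int]_k) : y != 0 -> c / 4 <= qform (schur a b S2) (intmx y).
  by move=> /minS2; apply: le_trans; lra.
have [U detU UB] := IH _ symS2 detS2 minS2'.
(* In rank one the determinant bounds the short vector; in higher rank the
   shortest vector of the complement does. *)
have aB : a <= `|d| + 4 * `|B|.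
  case: (posnP k) => [k0|k0].
    have : \det (schur a b S2) = 1.
      by move: (schur a b S2); rewrite k0 => M; rewrite det_mx00.
    move=> d1; have : a * \det (schur a b S2) <= `|d|.
      by rewrite -det_schur // -S1E detS1 (le_trans detS) // ler_norm.
    by rewrite d1 mulr1; have := normr_ge0 B; lra.
  have := UB (Ordinal k0); set y := col _ U => yB.
  have yn0 : y != 0.
    apply: contraNneq detU => yz.
    rewrite -det_tr; apply/det0P; exists (delta_mx ord0 (Ordinal k0)).
      by apply/eqP => /matrixP/(_ ord0 (Ordinal k0)) /eqP; rewrite !mxE !eqxx.
    by rewrite -[delta_mx _ _]trmxK trmx_delta -trmx_mul -colE -/y yz trmx0.
  have := minS2 _ yn0; have := ler_norm B; have := normr_ge0 d; lra.
have [x xB] := choice (fun i => lift (col i U)).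
pose V : 'M[int]_(1 + k) := block_mx 1%:M (\row_i x i) 0 U.
exists (L *m V).
  rewrite det_mulmx (_ : \det V = \det U); last by rewrite /V det_ublock det1 mul1r.
  rewrite mulf_eq0 negb_or detU andbT.
  by move: Lu; rewrite unitmxE; apply: contraTneq => ->; rewrite unitr0.
move=> i; have -> : col i (L *m V) = L *m col i V by rewrite !colE mulmxA.
rewrite -qS1; case: (split_ordP (i : 'I_(1 + k))) => j ->.
  have -> : col (lshift k j) V = col_mx 1%:M 0.
    rewrite (ord1 j).
    by rewrite /V block_mxEh colKl col_col_mx ?col0; congr col_mx; apply/matrixP => u v; rewrite !mxE !ord1.
  rewrite qblock /intmx map_mx0 mulmx0 !mxE mulr0 addr0 expr1n mulr1.
  rewrite /qform mulmx0 mxE addr0.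
  by have := normr_ge0 B; lra.
have -> : col (rshift 1 j) V = col_mx (x j)%:M (col j U).
  rewrite /V block_mxEh colKr; rewrite col_col_mx; congr col_mx.
  by apply/matrixP => u v; rewrite !mxE !ord1.
have := xB j; have := UB j; have := ler_norm B; have := normr_ge0 d.
have := normr_ge0 B; lra.
Qed.
End Reduction.

(** * Arithmetic of the ring Z[x] / (x^4 - 2) *)

Section Quartic.
Local Open Scope ring_scope.

(** The square root of 2 is irrational. *)
Lemma sqr_eq_double_sqr (a b : int) : a ^+ 2 = 2 * b ^+ 2 -> a = 0 /\ b = 0.
Proof.
have [->|b0] := eqVneq b 0.
  by rewrite expr0n mulr0 => /eqP; rewrite sqrf_eq0 => /eqP.
move=> ab; have a0 : a != 0.
  by rewrite -sqrf_eq0 ab mulf_neq0 // sqrf_eq0.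
have /(congr1 (logn 2)) : (absz a ^ 2 = 2 * absz b ^ 2)%N.
  by rewrite -!abszX ab abszM.
rewrite lognM ?expn_gt0 ?absz_gt0 ?b0 // !lognX.
by move=> /(congr1 odd); rewrite oddD !oddM (@logn_prime 2 2).
Qed.

Variable K : numClosedFieldType.
Implicit Types (p q : {poly int}) (s : K).

Definition quartic_root s := s ^+ 4 == 2.

(** Elements of Z[x] / (x^4 - 2) are represented by arbitrary integer polynomials,
    and compared through their values at the fourth roots of 2; thus ring
    operations on representatives need no normalization. *)
Definition peval s : {poly int} -> K := horner_eval s \o map_poly intr.
HB.instance Definition _ s := GRing.RMorphism.on (peval s).

Lemma pevalC s (c : int) : peval s c%:P = c%:~R.
Proof. by rewrite /peval /= map_polyC /horner_eval hornerC. Qed.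

Lemma pevalXn s n : peval s 'X^n = s ^+ n.
Proof. by rewrite /peval /= map_polyXn /horner_eval hornerXn. Qed.

(** The coordinates of the class of [p] in the basis 1, x, x^2, x^3. *)
Definition qcoord p (k : nat) : int := (Pdiv.Ring.rmodp p ('X^4 - 2%:P))`_k.

Lemma peval_qcoord s p : quartic_root s ->
  peval s p = (qcoord p 0)%:~R + (qcoord p 1)%:~R * s + (qcoord p 2)%:~R * s ^+ 2
            + (qcoord p 3)%:~R * s ^+ 3.
Proof.
move=> /eqP s4; have mon : 'X^4 - 2%:P \is @monic int by rewrite monicXnsubC.
rewrite {1}(Pdiv.RingMonic.rdivp_eq mon p) rmorphD rmorphM /=.
have -> : peval s ('X^4 - 2%:P) = 0.
  by rewrite rmorphB /= pevalXn pevalC s4 subrr.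
rewrite mulr0 add0r /peval /horner_eval /= (horner_coef_wide (n:=4)).
  rewrite !big_ord_recl big_ord0 /bump /= !coef_map /= /qcoord.
  by rewrite expr0 expr1 mulr1 addr0 !addrA.
rewrite size_map_inj_poly ?rmorph0 //; last exact: intr_inj.
rewrite -ltnS; apply: leq_trans (Pdiv.Ring.ltn_rmodpN0 _ (monic_neq0 mon)) _.
by rewrite size_XnsubC.
Qed.

Lemma quartic_rootN s : quartic_root s -> quartic_root (- s).
Proof. by rewrite /quartic_root exprNn -signr_odd mul1r. Qed.

Lemma quartic_rootMi s : quartic_root s -> quartic_root ('i * s).
Proof.
by rewrite /quartic_root exprMn (exprM 'i 2 2) sqrCi sqrrN expr1n mul1r.
Qed.

(** The automorphism x |-> -x, which is complex conjugation at the imaginary roots. *)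
Definition flip p := p \Po (- 'X).

Lemma peval_flip s p : peval s (flip p) = peval (- s) p.
Proof.
by rewrite /peval /flip /= map_comp_poly rmorphN /= map_polyX /horner_eval horner_comp !hornerE.
Qed.

(** The relative norm p(x) p(-x) lies in Z[x^2], where x^2 is a square root of 2;
    it equals [rel_norm0 p + rel_norm1 p * x^2]. *)
Definition rel_norm0 p : int :=
  qcoord p 0 ^+ 2 + 2 * qcoord p 2 ^+ 2 - 4 * (qcoord p 1 * qcoord p 3).
Definition rel_norm1 p : int :=
  2 * (qcoord p 0 * qcoord p 2) - qcoord p 1 ^+ 2 - 2 * qcoord p 3 ^+ 2.
Definition pnorm p : int := rel_norm0 p ^+ 2 - 2 * rel_norm1 p ^+ 2.

Lemma rel_normE s p : quartic_root s ->
  peval s p * peval (- s) p = (rel_norm0 p)%:~R + (rel_norm1 p)%:~R * s ^+ 2.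
Proof.
move=> rs; rewrite !peval_qcoord ?quartic_rootN // /rel_norm0 /rel_norm1.
move: (qcoord p 0) (qcoord p 1) (qcoord p 2) (qcoord p 3) => a b c d.
apply/eqP; rewrite -subr_eq0; apply/eqP.
transitivity ((c%:~R ^+ 2 - 2 * b%:~R * d%:~R - d%:~R ^+ 2 * s ^+ 2) * (s ^+ 4 - 2)).
  by ring.
by rewrite (eqP rs) subrr mulr0.
Qed.

Lemma pnormE s p : quartic_root s ->
  (pnorm p)%:~R = peval s p * peval (- s) p * (peval ('i * s) p * peval (- ('i * s)) p).
Proof.
move=> rs; rewrite !rel_normE ?quartic_rootMi // exprMn sqrCi mulN1r /pnorm.
apply/eqP; rewrite -subr_eq0; apply/eqP.
transitivity ((rel_norm1 p)%:~R ^+ 2 * (s ^+ 4 - 2)); first by ring.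
by rewrite (eqP rs) subrr mulr0.
Qed.

(** If the norm A^2 - 2 B^2 vanishes, so do A and B. These two equations combine to
    (a^2 - 2c^2)^2 + 2 (b^2 - 2d^2)^2 = 0, a sum of two nonnegative terms, and
    irrationality of the square root of 2 applies to each. *)
Lemma pnorm_eq0 p : pnorm p = 0 ->
  [/\ qcoord p 0 = 0, qcoord p 1 = 0, qcoord p 2 = 0 & qcoord p 3 = 0].
Proof.
move=> /eqP; rewrite subr_eq0 => /eqP/sqr_eq_double_sqr[].
rewrite /rel_norm0 /rel_norm1.
move: (qcoord p 0) (qcoord p 1) (qcoord p 2) (qcoord p 3) => a b c d A0 B0.
have /eqP : (a ^+ 2 - 2 * c ^+ 2) ^+ 2 + 2 * (b ^+ 2 - 2 * d ^+ 2) ^+ 2 = 0.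
  have A1 : a ^+ 2 + 2 * c ^+ 2 = 4 * (b * d) by lia.
  have B1 : 2 * (a * c) = b ^+ 2 + 2 * d ^+ 2 by lia.
  transitivity ((a ^+ 2 + 2 * c ^+ 2) ^+ 2 - 2 * (2 * (a * c)) ^+ 2
     + 2 * (b ^+ 2 - 2 * d ^+ 2) ^+ 2); first by ring.
  by rewrite A1 B1; ring.
rewrite paddr_eq0 ?sqr_ge0 //; last by rewrite mulr_ge0 ?sqr_ge0.
rewrite [2 * _ == 0]mulf_eq0 !sqrf_eq0 !subr_eq0 /=.
by move=> /andP[/eqP/sqr_eq_double_sqr[-> ->] /eqP/sqr_eq_double_sqr[-> ->]].
Qed.

Lemma peval_pnorm_eq0 s p : quartic_root s -> pnorm p = 0 -> peval s p = 0.
Proof.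
by move=> rs /pnorm_eq0[c0 c1 c2 c3]; rewrite peval_qcoord // c0 c1 c2 c3 !mul0r !addr0.
Qed.

Lemma pnorm_peval_eq0 s p : quartic_root s -> peval s p = 0 -> pnorm p = 0.
Proof.
move=> rs p0; apply/eqP; rewrite -(intr_eq0 K) (pnormE _ rs) p0.
by rewrite !mul0r.
Qed.

(** An element whose conjugates have product smaller than 1 is zero, since the
    norm is an integer. *)
Lemma pnorm_lt1 t s p : quartic_root t -> quartic_root s ->
  `|peval t p| * `|peval (- t) p| * (`|peval ('i * t) p| * `|peval (- ('i * t)) p|) < 1 ->
  peval s p = 0.
Proof.
move=> rt rs; rewrite -!normrM -pnormE // -intr_norm ltrz1 => N1.
apply: peval_pnorm_eq0 => //; lia.
Qed.

(** The product of the other conjugates of [p]. *)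
Definition cofactor p : {poly int} :=
  flip p * ((rel_norm0 p)%:P - (rel_norm1 p)%:P * 'X^2).

Lemma cofactorE s p : quartic_root s -> peval s p * peval s (cofactor p) = (pnorm p)%:~R.
Proof.
move=> rs; rewrite rmorphM /= peval_flip mulrA rel_normE // /pnorm.
rewrite [peval s _]rmorphB /= [peval s (_ * _)]rmorphM /= !pevalC pevalXn.
apply/eqP; rewrite -subr_eq0; apply/eqP.
transitivity (- (rel_norm1 p)%:~R ^+ 2 * (s ^+ 4 - 2)); first by ring.
by rewrite (eqP rs) subrr mulr0.
Qed.

Lemma quartic_root_le2 s : quartic_root s -> `|s| <= 2.
Proof.
move=> /eqP s4; rewrite -(@ler_pXn2r _ 4) ?nnegrE // -normrX s4.
by rewrite normr_nat -natrX ler_nat.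
Qed.

(** The coordinates are recovered by summing t^k p(t) over the four roots t: only
    one coordinate survives, multiplied by 8. *)
Lemma qcoord_le s p (B : K) : quartic_root s ->
  (forall t, quartic_root t -> `|peval t p| <= B) ->
  forall k : 'I_4, `|(qcoord p k)%:~R : K| <= 8 * B.
Proof.
move=> rs pB.
have ri := quartic_rootMi rs.
have r2 (t : K) : quartic_root t -> `|t| <= 2 := @quartic_root_le2 t.
pose S k : K := s ^+ k * peval s p + (- s) ^+ k * peval (- s) p
  + (('i * s) ^+ k * peval ('i * s) p + (- ('i * s)) ^+ k * peval (- ('i * s)) p).
have B0 : 0 <= B by apply: le_trans (pB _ rs); exact: normr_ge0.
have term t k : quartic_root t -> (k < 5)%N -> `|t ^+ k * peval t p| <= 16 * B.
  move=> rt k4; rewrite normrM normrX ler_pM ?exprn_ge0 ?normr_ge0 ?pB //.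
  apply: (@le_trans _ _ (2 ^+ k)); first by rewrite lerXn2r ?nnegrE ?normr_ge0 ?r2.
  by rewrite -natrX ler_nat; case: k k4 => [|[|[|[|[]]]]].
have SB k : (k < 5)%N -> `|S k| <= 64 * B.
  move=> k4; rewrite /S.
  apply: le_trans (ler_normD _ _) _.
  have -> : 64 * B = (16 * B + 16 * B) + (16 * B + 16 * B) by ring.
  by apply: lerD; apply: le_trans (ler_normD _ _) _; apply: lerD; apply: term => //;
    rewrite ?quartic_rootN.
have fin (c : int) k : (k < 5)%N -> S k = 8 * c%:~R -> `|c%:~R : K| <= 8 * B.
  move=> k4 e; have := SB _ k4; rewrite e normrM normr_nat.
  have -> : 64 * B = 8 * (8 * B) by ring.
  by rewrite ler_pM2l ?ltr0n.
have s4 : (s ^+ 2) ^+ 2 = 2 by rewrite -exprM (eqP rs).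
have t2 : ('i * s) ^+ 2 = - s ^+ 2 by rewrite exprMn sqrCi mulN1r.
have SE k (a b c d : K) : a = (qcoord p 0)%:~R -> b = (qcoord p 1)%:~R ->
    c = (qcoord p 2)%:~R -> d = (qcoord p 3)%:~R -> S k = 
    s ^+ k * (a + b * s + c * s ^+ 2 + d * s ^+ 3)
    + (- s) ^+ k * (a + b * (- s) + c * (- s) ^+ 2 + d * (- s) ^+ 3)
    + (('i * s) ^+ k * (a + b * ('i * s) + c * ('i * s) ^+ 2 + d * ('i * s) ^+ 3)
    + (- ('i * s)) ^+ k *
      (a + b * (- ('i * s)) + c * (- ('i * s)) ^+ 2 + d * (- ('i * s)) ^+ 3)).
  by move=> -> -> -> ->; rewrite /S !peval_qcoord ?quartic_rootN.
have {}SE k := SE k _ _ _ _ erefl erefl erefl erefl.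
move: ('i * s) t2 SE => t t2 SE.
move: fin SE; move: (qcoord p) => c fin SE [[|[|[|[|//]]]] /= _].
- apply: (fin _ 4%N) => //; rewrite SE.
  transitivity (2 * ((c 0%N)%:~R * ((s ^+ 2) ^+ 2 + (t ^+ 2) ^+ 2)
                + (c 2%N)%:~R * ((s ^+ 2) ^+ 3 + (t ^+ 2) ^+ 3))); first by ring.
  rewrite t2; transitivity (4 * (c 0%N)%:~R * (s ^+ 2) ^+ 2); first by ring.
  by rewrite s4; ring.
- apply: (fin _ 3%N) => //; rewrite SE.
  transitivity (2 * ((c 1%N)%:~R * ((s ^+ 2) ^+ 2 + (t ^+ 2) ^+ 2)
                + (c 3%N)%:~R * ((s ^+ 2) ^+ 3 + (t ^+ 2) ^+ 3))); first by ring.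
  rewrite t2; transitivity (4 * (c 1%N)%:~R * (s ^+ 2) ^+ 2); first by ring.
  by rewrite s4; ring.
- apply: (fin _ 2%N) => //; rewrite SE.
  transitivity (2 * ((c 2%N)%:~R * ((s ^+ 2) ^+ 2 + (t ^+ 2) ^+ 2)
                + (c 0%N)%:~R * (s ^+ 2 + t ^+ 2))); first by ring.
  rewrite t2; transitivity (4 * (c 2%N)%:~R * (s ^+ 2) ^+ 2); first by ring.
  by rewrite s4; ring.
- apply: (fin _ 1%N) => //; rewrite SE.
  transitivity (2 * ((c 3%N)%:~R * ((s ^+ 2) ^+ 2 + (t ^+ 2) ^+ 2)
                + (c 1%N)%:~R * (s ^+ 2 + t ^+ 2))); first by ring.
  rewrite t2; transitivity (4 * (c 3%N)%:~R * (s ^+ 2) ^+ 2); first by ring.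
  by rewrite s4; ring.
Qed.

End Quartic.

(** * Clifford families and the complex sphere *)

Section ConjTranspose.
Local Open Scope ring_scope.
Variable K : numClosedFieldType.

Definition conjtr m n (A : 'M[K]_(m, n)) : 'M[K]_(n, m) := (map_mx Num.conj A)^T.

Lemma conjtrM m n p (A : 'M[K]_(m, n)) (B : 'M[K]_(n, p)) :
  conjtr (A *m B) = conjtr B *m conjtr A.
Proof. by rewrite /conjtr map_mxM trmx_mul. Qed.

Lemma conjtrK m n : cancel (@conjtr m n) (@conjtr n m).
Proof. by move=> A; apply/matrixP => i j; rewrite !mxE conjCK. Qed.

Lemma conjtr_int m n (A : 'M[int]_(m, n)) : conjtr (map_mx intr A) = (map_mx intr A)^T.
Proof. by apply/matrixP => i j; rewrite !mxE rmorph_int. Qed.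

Lemma conjtr_entry m n (A : 'M[K]_(m, n)) i j : conjtr A i j = (A j i)^*.
Proof. by rewrite !mxE. Qed.

Lemma conjtr_sqr_norm n (v : 'cV[K]_n) :
  (conjtr v *m v) ord0 ord0 = \sum_i `|v i ord0| ^+ 2.
Proof. by rewrite mxE; apply: eq_bigr => i _; rewrite conjtr_entry normCK mulrC. Qed.

Lemma entry_sqr_le n (v : 'cV[K]_n) i : `|v i ord0| ^+ 2 <= (conjtr v *m v) ord0 ord0.
Proof.
rewrite conjtr_sqr_norm (bigD1 i) //= lerDl; apply: sumr_ge0 => k _.
exact: exprn_ge0.
Qed.

Lemma conjtr_sqr_ge0 n (v : 'cV[K]_n) : 0 <= (conjtr v *m v) ord0 ord0.
Proof. by rewrite conjtr_sqr_norm; apply: sumr_ge0 => k _; exact: exprn_ge0. Qed.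

Lemma conjtr_sqr_eq0 n (v : 'cV[K]_n) : (conjtr v *m v) ord0 ord0 = 0 -> v = 0.
Proof.
move=> v0; apply/matrixP => i j; rewrite (ord1 j) mxE; apply/eqP.
by rewrite -normr_eq0 -sqrf_eq0 eq_le exprn_ge0 // -v0 entry_sqr_le.
Qed.

Lemma dot_le n (v : 'cV[K]_n) : `|(v^T *m v) ord0 ord0| <= (conjtr v *m v) ord0 ord0.
Proof.
rewrite conjtr_sqr_norm mxE (le_trans (ler_norm_sum _ _ _)) // ler_sum // => i _.
by rewrite mxE -expr2 normrX.
Qed.

(** Under both hypotheses the difference of [s] and its conjugate has length 0. *)
Lemma unit_real n (s : 'cV[K]_n) : s^T *m s = 1%:M -> conjtr s *m s = 1%:M ->
  conjtr s = s^T.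
Proof.
move=> ss hs.
suff /conjtr_sqr_eq0/eqP : (conjtr ((conjtr s)^T - s) *m ((conjtr s)^T - s)) ord0 ord0 = 0.
  by rewrite subr_eq0 => /eqP e; rewrite -{2}e trmxK.
have cT : conjtr ((conjtr s)^T - s) = s^T - conjtr s.
  by apply/matrixP => i j; rewrite !mxE rmorphB /= conjCK.
rewrite cT mulmxBl !mulmxBr ss hs -trmx_mul hs trmx1.
have -> : conjtr s *m (conjtr s)^T = 1%:M.
  have := congr1 (map_mx Num.conj) ss; rewrite map_mxM map_mx1 => <-.
  by congr (_ *m _); apply/matrixP => i j; rewrite !mxE.
by rewrite !subrr mxE.
Qed.

End ConjTranspose.

Section EntryBounds.
Local Open Scope ring_scope.
Variable K : numClosedFieldType.

Definition entries_le m n (b : K) (A : 'M[K]_(m, n)) := forall i j, `|A i j| <= b.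

Lemma entries_le_mul m n p a b (A : 'M[K]_(m, n)) (B : 'M[K]_(n, p)) :
  entries_le a A -> entries_le b B -> entries_le (n%:R * (a * b)) (A *m B).
Proof.
move=> Aa Bb i j; rewrite mxE (le_trans (ler_norm_sum _ _ _)) //.
rewrite mulr_natl; apply: (@le_trans _ _ (\sum_(k < n) a * b)).
  by apply: ler_sum => k _; rewrite normrM ler_pM.
by rewrite sumr_const card_ord.
Qed.

Lemma entries_le_ctr m n a (A : 'M[K]_(m, n)) : entries_le a A -> entries_le a (conjtr A).
Proof. by move=> Aa i j; rewrite conjtr_entry norm_conjC. Qed.

Lemma entries_le_tr m n a (A : 'M[K]_(m, n)) : entries_le a A -> entries_le a A^T.
Proof. by move=> Aa i j; rewrite mxE. Qed.

Lemma entries_le_trans m n a b (A : 'M[K]_(m, n)) : a <= b -> entries_le a A -> entries_le b A.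
Proof. by move=> ab Aa i j; exact: le_trans (Aa i j) ab. Qed.

Lemma entries_le_sqr n (v : 'cV[K]_n) b : 0 <= b ->
  (conjtr v *m v) ord0 ord0 <= b ^+ 2 -> entries_le b v.
Proof.
move=> b0 vb i j; rewrite (ord1 j) -(@ler_pXn2r _ 2) ?nnegrE //.
exact: le_trans (entry_sqr_le v i) vb.
Qed.

Lemma unitary_entries_le m n (A : 'M[K]_(m, n)) : conjtr A *m A = 1%:M -> entries_le 1 A.
Proof.
move=> AA i j; have := @entries_le_sqr _ (col j A) 1 ler01.
rewrite (_ : (conjtr (col j A) *m col j A) ord0 ord0 = 1) ?expr1n => [/(_ (lexx _) i ord0)|].
  by rewrite mxE.
have := congr1 (fun M : 'M[_]_n => M j j) AA; rewrite !mxE eqxx => e; apply: etrans e.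
by apply: eq_bigr => k _; rewrite !mxE.
Qed.

End EntryBounds.

Section Clifford.
Local Open Scope ring_scope.

(** The matrices 1, L_1, ..., L_n then satisfy L_k^2 = -1 and L_j L_k = - L_k L_j. *)
Definition clifford n (L : 'I_n.+1 -> 'M[int]_n.+1) : Prop :=
  L ord0 = 1%:M /\
  forall j k, (L j)^T *m L k + (L k)^T *m L j = (2 *+ (j == k))%:M.

Variables (K : numClosedFieldType) (n : nat) (L : 'I_n.+1 -> 'M[int]_n.+1).
Hypothesis LC : clifford L.
Local Notation m := n.+1.

Definition cliff k : 'M[K]_m := map_mx intr (L k).

Lemma cliff0 : cliff ord0 = 1%:M.
Proof. by rewrite /cliff LC.1 map_mx1. Qed.

Lemma cliff_trmulD j k :
  (cliff j)^T *m cliff k + (cliff k)^T *m cliff j = (2 *+ (j == k))%:M.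
Proof.
by rewrite /cliff !map_trmx -!map_mxM -map_mxD LC.2 map_scalar_mx rmorphMn.
Qed.

(** Each [cliff k] is symmetric or skew according to this sign. *)
Definition cliff_sign (k : 'I_m) : K := if k == ord0 then 1 else -1.

Lemma cliff_sign2 k : cliff_sign k * cliff_sign k = 1.
Proof. by rewrite /cliff_sign; case: ifP; rewrite ?mulrNN mulr1. Qed.

Lemma cliff_tr k : (cliff k)^T = cliff_sign k *: cliff k.
Proof.
rewrite /cliff_sign; case: eqVneq => [->|k0]; first by rewrite cliff0 trmx1 scale1r.
have := cliff_trmulD ord0 k; rewrite cliff0 trmx1 mul1mx mulmx1 eq_sym (negPf k0).
by rewrite mulr0n raddf0 addrC scaleN1r => /eqP; rewrite addr_eq0 => /eqP.
Qed.

Lemma cliff_multrD j k :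
  cliff j *m (cliff k)^T + cliff k *m (cliff j)^T = (2 *+ (j == k))%:M.
Proof.
have e a b : cliff a *m (cliff b)^T = (cliff_sign a * cliff_sign b) *: ((cliff a)^T *m cliff b).
  by rewrite !cliff_tr -scalemxAl -scalemxAr scalerA mulrAC cliff_sign2 mul1r.
rewrite !e [cliff_sign k * _]mulrC -scalerDr cliff_trmulD.
by case: eqVneq => [->|_]; rewrite ?cliff_sign2 ?scale1r // mulr0n raddf0 scaler0.
Qed.

Definition comb (c : 'I_m -> K) : 'M[K]_m := \sum_k c k *: cliff k.

Lemma comb_multrD c k :
  comb c *m (cliff k)^T + cliff k *m (comb c)^T = (2 * c k)%:M.
Proof.
rewrite /comb linear_sum /= mulmx_suml mulmx_sumr -big_split /=.
rewrite (eq_bigr (fun j => (c j * (2 *+ (j == k)))%:M)) => [|j _].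
  rewrite (bigD1 k) //= eqxx mulr1n mulrC big1 ?addr0 // => j /negPf ->.
  by rewrite mulr0n mulr0 raddf0.
by rewrite linearZ /= -scalemxAl -scalemxAr -scalerDr cliff_multrD scale_scalar_mx.
Qed.

Definition sqr_sum (c : 'I_m -> K) := \sum_k c k ^+ 2.

Lemma comb_orth c : sqr_sum c = 1 -> comb c *m (comb c)^T = 1%:M.
Proof.
move=> c1; set G := comb c.
have : G *m G^T + G *m G^T = 2%:M.
  have E1 : G *m G^T = \sum_k c k *: (cliff k *m G^T).
    by rewrite {1}/G mulmx_suml; apply: eq_bigr => k _; rewrite scalemxAl.
  have E2 : G *m G^T = \sum_k c k *: (G *m (cliff k)^T).
    rewrite {2}/G [(comb c)^T]linear_sum mulmx_sumr; apply: eq_bigr => k _ /=.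
    by rewrite linearZ /= scalemxAr.
  rewrite {1}E2 E1 -big_split /=.
  rewrite (eq_bigr (fun k => (2 * c k ^+ 2)%:M)) => [|k _].
    by rewrite -raddf_sum -mulr_sumr -/(sqr_sum c) c1 mulr1.
  by rewrite -scalerDr comb_multrD scale_scalar_mx; congr (_%:M); ring.
move/(congr1 (fun M => 2^-1 *: M)); rewrite scale_scalar_mx mulVf ?pnatr_eq0 // => <-.
by rewrite -mulr2n -[(G *m G^T) *+ 2]scaler_nat scalerA mulVf ?pnatr_eq0 // scale1r.
Qed.

Lemma comb_tr c : (comb c)^T = (2 * c ord0)%:M - comb c.
Proof.
apply/eqP; rewrite eq_sym subr_eq eq_sym; apply/eqP.
by rewrite -(comb_multrD c ord0) cliff0 trmx1 mulmx1 mul1mx addrC.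
Qed.

(** These coefficients are real for k = 0 and imaginary otherwise: they are the
    vectors of Minkowski space R^(1,n), on which [sqr_sum] is the Lorentz form. *)
Definition hermitian_coef (c : 'I_m -> K) := forall k, (c k)^* = cliff_sign k * c k.

Lemma comb_ctr c : hermitian_coef c -> conjtr (comb c) = comb c.
Proof.
move=> hc; rewrite /comb /conjtr map_mx_sum linear_sum; apply: eq_bigr => k _ /=.
rewrite map_mxZ linearZ /= [(_ : 'M[_]_m)^T](@conjtr_int K) -/(cliff k) cliff_tr scalerA.
by rewrite hc mulrAC cliff_sign2 mul1r.
Qed.

(** The tensor sum_k L_k (x) L_k, pulled back along [A] as a sesquilinear form, is
    stored as the Gram matrix of the vectorized matrices A^* L_k A. In this form
    composition with a linear map acts by right multiplication on the rows. *)
Definition fierz_rows p (A : 'M[K]_(m, p)) : 'M[K]_(m, p * p) :=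
  \matrix_k mxvec (conjtr A *m cliff k *m A).

Definition fierz p (A : 'M[K]_(m, p)) : 'M[K]_(p * p) := (fierz_rows A)^T *m fierz_rows A.

Lemma fierz_rows_mulmx p q (A : 'M[K]_(m, p)) (X : 'M[K]_(p, q)) :
  fierz_rows (A *m X) = fierz_rows A *m lin_mx (mulmxr X \o mulmx (conjtr X)).
Proof.
apply/row_matrixP => k; rewrite row_mul !rowK mul_vec_lin /=.
by rewrite conjtrM !mulmxA.
Qed.

Lemma fierz_mulmxr p q (A B : 'M[K]_(m, p)) (X : 'M[K]_(p, q)) :
  fierz A = fierz B -> fierz (A *m X) = fierz (B *m X).
Proof.
rewrite /fierz !fierz_rows_mulmx !trmx_mul => e.
by rewrite mulmxA -[_ *m _ *m fierz_rows A]mulmxA e !mulmxA.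
Qed.

Lemma fierzE p (A : 'M[K]_(m, p)) a b c d :
  fierz A (mxvec_index a b) (mxvec_index c d) =
  \sum_k (conjtr A *m cliff k *m A) a b * (conjtr A *m cliff k *m A) c d.
Proof.
have e k i j : fierz_rows A k (mxvec_index i j) = (conjtr A *m cliff k *m A) i j.
  by rewrite mxE mxvecE.
by rewrite mxE; apply: eq_bigr => k _; rewrite [_^T _ _]mxE !e.
Qed.

Lemma fierzP p (A B : 'M[K]_(m, p)) :
  (forall a b c d, fierz A (mxvec_index a b) (mxvec_index c d) =
                   fierz B (mxvec_index a b) (mxvec_index c d)) ->
  fierz A = fierz B.
Proof.
move=> e; apply/matrixP => i j.
by case/mxvec_indexP: i => a b; case/mxvec_indexP: j => c d; exact: e.
Qed.

(** The Clifford relation turns g L_k g into a reflection of L_k, up to sign. *)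
Lemma comb_cliff_comb c k : sqr_sum c = 1 ->
  comb c *m cliff k *m comb c = cliff_sign k *: ((2 * c k) *: comb c - cliff k).
Proof.
move=> c1; have /mulmx1C GG := comb_orth c1.
have e : cliff k = cliff_sign k *: (cliff k)^T by rewrite cliff_tr scalerA cliff_sign2 scale1r.
rewrite [X in _ *m X *m _]e -scalemxAr -scalemxAl; congr (_ *: _).
rewrite -[comb c *m (cliff k)^T](addrK (cliff k *m (comb c)^T)) comb_multrD.
by rewrite mulmxBl mul_scalar_mx -mulmxA GG mulmx1.
Qed.

(** By [comb_cliff_comb] the rows of [fierz_rows (comb c)] arise from the original
    ones by the reflection 2 u^T u - 1 along c followed by sign changes, both of
    which are orthogonal, so the Gram matrix is unchanged. *)
Lemma fierz_comb c : hermitian_coef c -> sqr_sum c = 1 ->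
  fierz (comb c) = fierz 1%:M.
Proof.
move=> hc c1; pose T := fierz_rows 1%:M; pose u := \row_k c k; pose e := \row_k cliff_sign k.
have uu : u *m u^T = 1%:M.
  rewrite [LHS]mx11_scalar mxE -c1; congr (_%:M).
  by apply: eq_bigr => k _; rewrite !mxE expr2.
have rowT k : row k T = mxvec (cliff k).
  by rewrite rowK mulmx1 /conjtr map_mx1 trmx1 mul1mx.
have uT : u *m T = mxvec (comb c).
  rewrite mulmx_sum_row /comb linear_sum; apply: eq_bigr => k _.
  by rewrite rowT mxE linearZ.
pose W := 2 *: (u^T *m u) - 1%:M.
have tE : fierz_rows (comb c) = diag_mx e *m (W *m T).
  apply/row_matrixP => k; rewrite rowK comb_ctr // comb_cliff_comb //.
  rewrite row_mul row_diag_mx -scalemxAl -rowE mxE linearZ /= linearB /= linearZ /=; congr (_ *: _).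
  rewrite row_mul /W linearB /= row1 linearZ /= row_mul mulmxBl -rowE rowT.
  rewrite -scalemxAl -mulmxA uT; congr (_ - _).
  rewrite [row k _]mx11_scalar mul_scalar_mx scalerA; congr (_ *: _).
  by rewrite !mxE.
have ee : (diag_mx e)^T *m diag_mx e = 1%:M.
  rewrite tr_diag_mx mulmx_diag -diag_const_mx; congr diag_mx.
  by apply/rowP => k; rewrite !mxE cliff_sign2.
have WT : W^T = W by rewrite /W linearB linearZ /= trmx_mul trmxK trmx1.
have WW : W *m W = 1%:M.
  rewrite {2}/W mulmxBr mulmx1 -scalemxAr /W mulmxBl mul1mx -scalemxAl mulmxA.
  rewrite -(mulmxA u^T u) uu mulmx1 scalerBr scalerA opprB addrACA.
  by rewrite -opprD -scalerDl -natrM -natrD addrAC subrr add0r.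
by rewrite /fierz tE !trmx_mul -!mulmxA (mulmxA _ (diag_mx e)) ee mul1mx WT
  (mulmxA W) WW mul1mx.
Qed.

(** The vectors L_k z; there are m of them, so for z on the sphere they form an
    orthonormal frame whose first member is z. *)
Definition frame (z : 'cV[K]_m) : 'M[K]_m := \matrix_(i, k) (cliff k *m z) i ord0.

Lemma frame_orth z : z^T *m z = 1%:M -> (frame z)^T *m frame z = 1%:M.
Proof.
move=> zz; apply/matrixP => j k; pose D a b := (cliff a)^T *m cliff b.
have E a b : ((frame z)^T *m frame z) a b = (z^T *m D a b *m z) ord0 ord0.
  rewrite /D mulmxA -trmx_mul -mulmxA [LHS]mxE [RHS]mxE.
  by apply: eq_bigr => i _; rewrite ![_^T _ _]mxE ![frame _ _ _]mxE.
have S : ((frame z)^T *m frame z) j k = ((frame z)^T *m frame z) k j.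
  by rewrite -[in RHS](trmxK (frame z)) -trmx_mul trmxK [RHS]mxE.
have : ((frame z)^T *m frame z) j k + ((frame z)^T *m frame z) k j = 2 * (j == k)%:R.
  rewrite !E; have := cliff_trmulD j k; rewrite -/(D j k) -/(D k j) => e.
  transitivity ((z^T *m (D j k + D k j) *m z) ord0 ord0).
    by rewrite mulmxDr mulmxDl [RHS]mxE.
  rewrite e mul_mx_scalar -scalemxAl zz [LHS]mxE [(1%:M : 'M[_]_1) _ _]mxE eqxx mulr1.
  by rewrite mulr_natr.
rewrite -S -mulr2n -[_ *+ 2]mulr_natl => /(mulfI _) -> ; last by rewrite pnatr_eq0.
by rewrite [RHS]mxE.
Qed.

Lemma frame_ord0 z : frame z *m delta_mx ord0 ord0 = z.
Proof.
rewrite -colE; apply/matrixP => i j; rewrite (ord1 j) !mxE.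
by have := congr1 (fun M : 'cV_m => M i ord0) (mul1mx z); rewrite -cliff0 mxE.
Qed.

(** Up to factors of i, the point of hyperbolic space below z. *)
Definition coef (z : 'cV[K]_m) k : K := (conjtr z *m cliff k *m z) ord0 ord0.

Lemma coef0 z : coef z ord0 = (conjtr z *m z) ord0 ord0.
Proof. by rewrite /coef cliff0 mulmx1. Qed.

Lemma coef_hermitian z : hermitian_coef (coef z).
Proof.
move=> k; rewrite /coef -conjtr_entry !conjtrM conjtrK mulmxA conjtr_int -/(cliff k) cliff_tr.
by rewrite -scalemxAr -scalemxAl mxE.
Qed.

(** The composition identity: the numbers [coef z k] are the coordinates of the
    conjugate of z in the orthonormal frame of z. *)
Lemma coef_sqr_sum z : z^T *m z = 1%:M -> sqr_sum (coef z) = 1.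
Proof.
move=> zz; have /mulmx1C ff := frame_orth zz.
have zc : conjtr z *m (conjtr z)^T = 1%:M.
  by rewrite /conjtr trmxK map_trmx -map_mxM zz map_mx1.
have cE : \row_k coef z k = conjtr z *m frame z.
  apply/rowP => k; rewrite mxE /coef -mulmxA [LHS]mxE [RHS]mxE.
  by apply: eq_bigr => i _; rewrite [frame _ _ _]mxE.
have : (\row_k coef z k) *m (\row_k coef z k)^T = 1%:M.
  by rewrite cE trmx_mul mulmxA -(mulmxA _ (frame z)) ff mulmx1 zc.
move=> /matrixP/(_ ord0 ord0); rewrite !mxE eqxx => e; apply: etrans e.
by apply: eq_bigr => k _; rewrite !mxE expr2.
Qed.

Definition boost_norm z : K := sqrtC (2 + 2 * coef z ord0).

(** The hyperbolic point h = [comb (coef z)] is a positive Hermitian matrix with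
    h + h^-1 = 2 [coef z ord0], so (h + 1) / sqrt (2 + 2 [coef z ord0]) is its square
    root: the Lorentz boost that takes the point to the origin. *)
Definition boost z : 'M[K]_m :=
  comb (fun k => (boost_norm z)^-1 * (coef z k + (k == ord0)%:R)).

Lemma boostE z : boost z = (boost_norm z)^-1 *: (comb (coef z) + 1%:M).
Proof.
rewrite /boost /comb -cliff0 (_ : cliff ord0 = \sum_k (k == ord0)%:R *: cliff k).
  rewrite -big_split scaler_sumr; apply: eq_bigr => k _ /=.
  by rewrite -scalerDl scalerA.
rewrite (bigD1 ord0) //= scale1r big1 ?addr0 // => k /negPf ->.
by rewrite scale0r.
Qed.

Lemma boost_norm_ge1 z : 1 <= boost_norm z.
Proof.
rewrite -[1]sqrtC1 ler_sqrtC ?nnegrE ?ler01 //.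
  by rewrite -[leLHS]addr0 lerD ?ler1n // mulr_ge0 // coef0 conjtr_sqr_ge0.
by rewrite addr_ge0 // mulr_ge0 // coef0 conjtr_sqr_ge0.
Qed.

Lemma boost_norm_sqr z : boost_norm z ^+ 2 = 2 + 2 * coef z ord0.
Proof. exact: sqrtCK. Qed.

Section OnSphere.
Variable z : 'cV[K]_m.
Hypothesis zz : z^T *m z = 1%:M.

Let N_neq0 : boost_norm z != 0.
Proof. by rewrite gt_eqF // (lt_le_trans ltr01) // boost_norm_ge1. Qed.

Lemma boost_hermitian :
  hermitian_coef (fun k => (boost_norm z)^-1 * (coef z k + (k == ord0)%:R)).
Proof.
move=> k; rewrite rmorphM rmorphD /= coef_hermitian rmorph_nat.
have -> : ((boost_norm z)^-1)^* = (boost_norm z)^-1.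
  apply/CrealP/ger0_real; rewrite invr_ge0 (le_trans ler01) //.
  exact: boost_norm_ge1.
rewrite mulrCA; congr (_ * _); rewrite mulrDr; congr (_ + _).
by rewrite /cliff_sign; case: eqVneq => _; rewrite ?mulr1 ?mulr0.
Qed.

Lemma boost_sqr_sum :
  sqr_sum (fun k => (boost_norm z)^-1 * (coef z k + (k == ord0)%:R)) = 1.
Proof.
rewrite /sqr_sum (eq_bigr (fun k => (boost_norm z) ^- 2 *
   (coef z k ^+ 2 + (k == ord0)%:R * (2 * coef z k + 1)))) => [|k _]; last first.
  by rewrite exprMn exprVn; congr (_ * _); case: eqVneq => _ /=; ring.
rewrite -mulr_sumr big_split /= -/(sqr_sum (coef z)) coef_sqr_sum //.
rewrite (bigD1 ord0) //= big1 => [|k /negPf ->]; last by rewrite mul0r.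
rewrite mul1r addr0 boost_norm_sqr mulrC.
rewrite (_ : 1 + _ = 2 + 2 * coef z ord0); last by ring.
by rewrite divff // -boost_norm_sqr expf_neq0.
Qed.

Lemma boost_orth : boost z *m (boost z)^T = 1%:M.
Proof. exact: comb_orth boost_sqr_sum. Qed.

Lemma boost_ctr : conjtr (boost z) = boost z.
Proof. exact: comb_ctr boost_hermitian. Qed.

Lemma fierz_boost : fierz (boost z) = fierz 1%:M.
Proof. exact: fierz_comb boost_hermitian boost_sqr_sum. Qed.

Lemma boost_sqr : boost z *m boost z = comb (coef z).
Proof.
have GG := comb_orth (coef_sqr_sum zz); set G := comb _ in GG *.
have : G *m G = (2 * coef z ord0) *: G - 1%:M.
  rewrite -GG /G [in RHS]comb_tr mulmxBr mul_mx_scalar opprB addrC subrK.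
  by [].
move=> G2; rewrite !boostE -/G -scalemxAl -scalemxAr scalerA -invfM -expr2.
rewrite boost_norm_sqr mulmxDl mul1mx mulmxDr mulmx1 G2.
rewrite [G + _]addrC addrACA subrK -mulr2n -[G *+ 2]scaler_nat -scalerDl [_ + 2]addrC.
by rewrite scalerA mulVf ?scale1r // -boost_norm_sqr expf_neq0.
Qed.

(** Since the square of the boost is the matrix of the hyperbolic point, the image
    of z has Hermitian length sum_k (coef z k)^2 = 1, equal to its complex length. *)
Lemma boost_real : conjtr (boost z *m z) = (boost z *m z)^T.
Proof.
apply: unit_real.
  by rewrite trmx_mul mulmxA -(mulmxA z^T) (mulmx1C boost_orth) mulmx1.
rewrite conjtrM boost_ctr mulmxA -(mulmxA (conjtr z)) boost_sqr.
rewrite [LHS]mx11_scalar /comb mulmx_sumr mulmx_suml summxE.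
rewrite -(coef_sqr_sum zz); congr (_%:M); apply: eq_bigr => k _.
by rewrite -scalemxAr -scalemxAl mxE expr2.
Qed.

Lemma boost_unit : conjtr (boost z *m z) *m (boost z *m z) = 1%:M.
Proof.
rewrite boost_real.
by rewrite trmx_mul mulmxA -(mulmxA z^T) (mulmx1C boost_orth) mulmx1.
Qed.

End OnSphere.

Lemma coef_real s : s^T *m s = 1%:M -> conjtr s = s^T -> forall k, coef s k = (k == ord0)%:R.
Proof.
move=> ss sr k; rewrite /coef sr.
have [->|k0] := eqVneq k ord0; first by rewrite cliff0 mulmx1 ss mxE.
have : (s^T *m cliff k *m s)^T = - (s^T *m cliff k *m s).
  rewrite !trmx_mul trmxK cliff_tr /cliff_sign (negPf k0) scaleN1r mulNmx mulmxN.
  by rewrite mulmxA.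
move=> /matrixP/(_ ord0 ord0); rewrite [LHS]mxE [RHS]mxE => /eqP.
by rewrite -subr_eq0 opprK -mulr2n mulrn_eq0 => /eqP.
Qed.

(** Contracting the tensor of [A] twice with s gives the Hermitian form attached to
    the point A s, pulled back by [A]. *)
Lemma fierz_moment (s : 'cV[K]_m) (A : 'M[K]_m) :
  mxvec ((conjtr s)^T *m s^T) *m fierz A =
  mxvec (\sum_k coef (A *m s) k *: (conjtr A *m cliff k *m A)).
Proof.
rewrite /fierz mulmxA mulmx_sum_row linear_sum; apply: eq_bigr => k _ /=.
rewrite linearZ /= rowK; congr (_ *: _).
transitivity ((mxvec ((conjtr s)^T *m s^T) *m (row k (fierz_rows A))^T) ord0 ord0).
  by rewrite [LHS]mxE [RHS]mxE; apply: eq_bigr => i _; rewrite !mxE.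
by rewrite rowK mxvec_dotmul trmxK /coef conjtrM !mulmxA.
Qed.

(** The Hermitian form attached to a real unit vector is the standard one, because
    the L_k with k > 0 are skew. A matrix that preserves the tensor thus preserves
    the standard Hermitian form. *)
Lemma fierz_unitary (s : 'cV[K]_m) (A : 'M[K]_m) :
  s^T *m s = 1%:M -> conjtr s = s^T ->
  (A *m s)^T *m (A *m s) = 1%:M -> conjtr (A *m s) = (A *m s)^T ->
  fierz A = fierz 1%:M -> conjtr A *m A = 1%:M.
Proof.
have only0 t (B : 'M[K]_m) : t^T *m t = 1%:M -> conjtr t = t^T ->
    \sum_k coef t k *: (conjtr B *m cliff k *m B) = conjtr B *m B.
  move=> tt tr; rewrite (bigD1 ord0) //= big1 => [|k /negPf k0].
    by rewrite coef_real // scale1r cliff0 mulmx1 addr0.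
  by rewrite coef_real // k0 scale0r.
move=> ss sr AA Ar eF; have := fierz_moment s A; rewrite eF fierz_moment mul1mx.
move=> /(can_inj mxvecK); rewrite !only0 // => <-.
by rewrite /conjtr map_mx1 trmx1 mulmx1.
Qed.

Lemma cliff_entries_le k : entries_le 1 (cliff k).
Proof.
apply: unitary_entries_le; rewrite conjtr_int -/(cliff k).
have := cliff_trmulD k k; rewrite eqxx -mulr2n -[(_ *m _) *+ 2]scaler_nat => e.
apply: (@scalerI _ _ (2 : K)); first by rewrite pnatr_eq0.
by rewrite e scale_scalar_mx mulr1.
Qed.

Lemma frame_entries_le z b : entries_le b z -> entries_le (m%:R * b) (frame z).
Proof.
move=> zb i k; rewrite mxE -[b]mul1r.
exact: entries_le_mul (cliff_entries_le k) zb _ _.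
Qed.

Definition boost_bound (b : K) : K := m%:R * (m%:R * (m%:R * (b * 1) * b) + 1).

Lemma boost_entries_le z b : entries_le b z -> entries_le (boost_bound b) (boost z).
Proof.
move=> zb i j; rewrite /boost /comb summxE (le_trans (ler_norm_sum _ _ _)) //.
rewrite /boost_bound mulr_natl.
apply: (@le_trans _ _ (\sum_(k < m) (m%:R * (m%:R * (b * 1) * b) + 1))); last first.
  by rewrite sumr_const card_ord.
apply: ler_sum => k _; rewrite mxE normrM -[leRHS]mulr1 ler_pM ?normr_ge0 //; last first.
  exact: cliff_entries_le.
have N1 := boost_norm_ge1 z; have N0 := lt_le_trans ltr01 N1.
rewrite normrM normfV (ger0_norm (ltW N0)) ler_pdivrMl //.
apply: (@le_trans _ _ (m%:R * (m%:R * (b * 1) * b) + 1)); last first.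
  rewrite ler_peMl // addr_ge0 //.
  have b0 : 0 <= b by apply: le_trans (zb i ord0).
  by rewrite !mulr_ge0 ?ler0n.
apply: le_trans (ler_normD _ _) _; apply: lerD.
  exact: entries_le_mul (entries_le_mul (entries_le_ctr zb) (cliff_entries_le k)) zb _ _.
by case: eqP => _; rewrite ?normr1 ?normr0.
Qed.

End Clifford.

(** * Clifford families from the Cayley-Dickson algebras *)

Section CayleyDickson.
Local Open Scope ring_scope.

(** The product of the basis elements e_i and e_j of the Cayley-Dickson algebra of
    dimension 2^d, as a sign (true for minus) and an index. The four cases are those
    of (a, b) (c, e) = (a c - e^* b, e a + b c^* ); conjugation changes the sign of
    every basis element but e_0. *)
Fixpoint cd_mul (d i j : nat) : bool * nat :=
  if d is d'.+1 then
    let h := (2 ^ d')%N in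
    let i0 := (if i < h then i else i - h)%N in
    let j0 := (if j < h then j else j - h)%N in
    match (i < h)%N, (j < h)%N with
    | true, true => cd_mul d' i0 j0
    | true, false => let: (s, r) := cd_mul d' j0 i0 in (s, h + r)%N
    | false, true => let: (s, r) := cd_mul d' i0 j0 in (s (+) (j0 != 0%N), h + r)%N
    | false, false => let: (s, r) := cd_mul d' j0 i0 in (~~ s (+) (j0 != 0%N), r)
    end
  else (false, 0%N).

Definition cd_entry d (k i j : nat) : int :=
  let: (s, r) := cd_mul d k j in if r == i then (if s then -1 else 1) else 0.

Definition cd_gen d n (k : 'I_n.+1) : 'M[int]_n.+1 := \matrix_(i, j) cd_entry d k i j.

Definition cd_check d n : bool :=
  let I := iota 0 n.+1 in
  all (fun i => all (fun j => cd_entry d 0 i j == (i == j)%:R) I) I &&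
  all (fun j => all (fun k => all (fun a => all (fun b =>
    foldr +%R 0 [seq cd_entry d j l a * cd_entry d k l b
                     + cd_entry d k l a * cd_entry d j l b | l <- I]
    == if (j == k) && (a == b) then 2 else 0) I) I) I) I.

Lemma cd_clifford d n : cd_check d n -> clifford (@cd_gen d n).
Proof.
have in_iota (i : 'I_n.+1) : (i : nat) \in iota 0 n.+1 by rewrite mem_iota ltn_ord.
move=> /andP[/allP one /allP rel]; split.
  apply/matrixP => i j; rewrite !mxE.
  by have /allP/(_ j (in_iota j))/eqP := one i (in_iota i).
move=> j k; apply/matrixP => a b; rewrite !mxE -big_split /=.
have /allP/(_ k (in_iota k))/allP/(_ a (in_iota a))/allP/(_ b (in_iota b))/eqP :=
  rel j (in_iota j).
rewrite foldrE big_map -{1}[n.+1]subn0 -/(index_iota 0 n.+1) big_mkord => e.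
transitivity (if ((j : nat) == k) && ((a : nat) == b) then 2 else 0 : int).
  by rewrite -e; apply: eq_bigr => l _; rewrite !mxE.
rewrite -!val_eqE /=; case: (_ == _) => /=; case: (_ == _) => //=.
Qed.

(** The octonion table contains those of the quaternions and of the complex numbers
    as its leading blocks, so depth 3 serves the three cases. *)
Lemma exists_clifford n : n = 1%N \/ n = 3%N \/ n = 7%N ->
  exists L : 'I_n.+1 -> 'M[int]_n.+1, clifford L.
Proof.
move=> h; exists (@cd_gen 3 n); apply: cd_clifford.
by case: h => [->|[->|->]]; vm_compute.
Qed.
End CayleyDickson.

(** * Matrices over Z[x] / (x^4 - 2) and their lattice forms *)

Section IntegralMatrices.
Local Open Scope ring_scope.
Variable K : numClosedFieldType.
Variable m : nat.
Local Notation N := (m + m + (m + m))%N.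

Definition evalmx (s : K) p q (P : 'M[{poly int}]_(p, q)) : 'M[K]_(p, q) := map_mx (peval s) P.

Lemma peval_conj s p : (peval s p)^* = peval (s^* : K) p.
Proof.
rewrite /peval /= /horner_eval -horner_map; congr (_.[_]).
by rewrite -map_poly_comp; apply: eq_map_poly => c /=; rewrite rmorph_int.
Qed.

Lemma evalmx_conj s p q (P : 'M[{poly int}]_(p, q)) :
  map_mx Num.conj (evalmx s P) = evalmx s^* P.
Proof. by apply/matrixP => i j; rewrite !mxE peval_conj. Qed.

(** The matrix over Z[x] / (x^4 - 2) whose coordinates in the basis 1, x, x^2, x^3
    are the four blocks of [A]. *)
Definition quartic_mx p (A : 'M[int]_(N, p)) : 'M[{poly int}]_(m, p) :=
  \matrix_(i, j) Poly [:: usubmx (usubmx A) i j; dsubmx (usubmx A) i j;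
                          usubmx (dsubmx A) i j; dsubmx (dsubmx A) i j].

Lemma qcoord_Poly (a b c d : int) k : qcoord (Poly [:: a; b; c; d]) k = [:: a; b; c; d]`_k.
Proof.
rewrite /qcoord Pdiv.Ring.rmodp_small ?coef_Poly //.
by rewrite size_XnsubC // ltnS; exact: size_Poly.
Qed.

Definition powers (s : K) : 'M[K]_(m, N) :=
  row_mx (row_mx 1%:M s%:M) (row_mx (s ^+ 2)%:M (s ^+ 3)%:M).

Lemma evalmx_quartic_mx s p (A : 'M[int]_(N, p)) : quartic_root s ->
  evalmx s (quartic_mx A) = powers s *m map_mx intr A.
Proof.
move=> rs; rewrite -{2}[A]vsubmxK -[usubmx A]vsubmxK -[dsubmx A]vsubmxK.
rewrite !map_col_mx !mul_row_col !mul_scalar_mx scale1r.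
apply/matrixP => i j; rewrite !mxE peval_qcoord // !qcoord_Poly /=.
move: (A _ _) (A _ _) (A _ _) (A _ _) => a b c d; ring.
Qed.

Lemma evalmx_quartic_mx_inj s p (A : 'M[int]_(N, p)) : quartic_root s ->
  evalmx s (quartic_mx A) = 0 -> A = 0.
Proof.
move=> rs A0.
have z i j : [/\ usubmx (usubmx A) i j = 0, dsubmx (usubmx A) i j = 0,
                usubmx (dsubmx A) i j = 0 & dsubmx (dsubmx A) i j = 0].
  have := congr1 (fun M : 'M[_]_(m, p) => M i j) A0; rewrite !mxE.
  by move/(pnorm_peval_eq0 rs)/pnorm_eq0; rewrite !qcoord_Poly.
rewrite -[A]vsubmxK -[usubmx A]vsubmxK -[dsubmx A]vsubmxK.
rewrite (_ : usubmx (usubmx A) = 0); last first.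
  by apply/matrixP => i j; have [-> _ _ _] := z i j; rewrite [RHS]mxE.
rewrite (_ : dsubmx (usubmx A) = 0); last first.
  by apply/matrixP => i j; have [_ -> _ _] := z i j; rewrite [RHS]mxE.
rewrite (_ : usubmx (dsubmx A) = 0); last first.
  by apply/matrixP => i j; have [_ _ -> _] := z i j; rewrite [RHS]mxE.
rewrite (_ : dsubmx (dsubmx A) = 0); last first.
  by apply/matrixP => i j; have [_ _ _ ->] := z i j; rewrite [RHS]mxE.
by rewrite !col_mx0.
Qed.

(** The complex numbers are seen as a closed field [K] together with an order
    embedding of the reals onto its real elements. *)
Variables (R : realType) (emb : {rmorphism R -> K}).
Hypothesis emb_le : {mono emb : x y / x <= y}.
Hypothesis emb_real : forall x : K, x \is Num.real -> exists r, x = emb r.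

Definition fourth_root2 : K := emb (Num.sqrt (Num.sqrt 2)).
Local Notation w := fourth_root2.
Local Notation iw := ('i * w).

Lemma fourth_root2P : quartic_root w.
Proof.
rewrite /quartic_root /fourth_root2 -rmorphXn /= (exprM _ 2 2) !sqr_sqrtr ?sqrtr_ge0 //.
by rewrite rmorph_nat.
Qed.

Lemma emb_conj r : (emb r)^* = emb r.
Proof.
apply/CrealP; rewrite realE.
by rewrite -[0](rmorph0 emb) !emb_le -realE num_real.
Qed.

Lemma fourth_root2_conj : w^* = w. Proof. exact: emb_conj. Qed.
Lemma iw_conj : iw^* = - iw. Proof. by rewrite rmorphM /= fourth_root2_conj conjCi mulNr. Qed.
Lemma iw_root : quartic_root iw. Proof. exact/quartic_rootMi/fourth_root2P. Qed.

Definition sqnorm q (v : 'cV[K]_q) : K := (conjtr v *m v) ord0 ord0.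

Section Place.
Variable g : 'M[K]_m.

Definition conjmx := map_mx Num.conj g.

(** The four embeddings of an integral vector, the complex one twisted by [g]. Its
    Hermitian square is the lattice form attached to [g]. *)
Definition place_mx : 'M[K]_N :=
  col_mx (col_mx (g *m powers iw) (conjmx *m powers (- iw)))
         (col_mx (powers w) (powers (- w))).

Definition place_form : 'M[K]_N := conjtr place_mx *m place_mx.

Lemma conjtr_col_mx p q r (A : 'M[K]_(p, r)) (B : 'M[K]_(q, r)) :
  conjtr (col_mx A B) = row_mx (conjtr A) (conjtr B).
Proof. by rewrite /conjtr map_col_mx tr_col_mx. Qed.

(** Conjugation exchanges the two complex places. *)
Lemma place_form_conj : map_mx Num.conj place_form = place_form.
Proof.
rewrite /place_form /place_mx !conjtr_col_mx !mul_row_col !map_mxD !map_mxM.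
have cc p q (A : 'M[K]_(p, q)) : map_mx Num.conj (conjtr A) = conjtr (map_mx Num.conj A).
  by rewrite /conjtr !map_trmx.
have cp s : map_mx Num.conj (powers s) = powers s^*.
  by rewrite /powers !map_row_mx map_mx1 !map_scalar_mx !rmorphXn.
rewrite !cc !map_mxM !cp !rmorphN /= fourth_root2_conj iw_conj opprK.
have -> : map_mx Num.conj conjmx = g by apply/matrixP => i j; rewrite !mxE conjCK.
by rewrite -/conjmx [X in X + _ = _]addrC.
Qed.

Lemma place_form_real : exists S : 'M[R]_N, place_form = map_mx emb S.
Proof.
have re i j : place_form i j \is Num.real.
  apply/CrealP; have := congr1 (fun M : 'M[_]_N => M i j) place_form_conj.
  by rewrite [LHS]mxE.
exists (\matrix_(i, j) projT1 (cid (emb_real (re i j)))).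
by apply/matrixP => i j; rewrite [RHS]mxE [X in emb X]mxE; case: cid.
Qed.

Lemma place_form_value (z : 'cV[int]_N) :
  ((map_mx intr z)^T *m place_form *m map_mx intr z) ord0 ord0 =
  sqnorm (g *m evalmx iw (quartic_mx z)) + sqnorm (conjmx *m evalmx (- iw) (quartic_mx z))
  + (sqnorm (evalmx w (quartic_mx z)) + sqnorm (evalmx (- w) (quartic_mx z))).
Proof.
transitivity (sqnorm (place_mx *m map_mx intr z)).
  by rewrite /sqnorm conjtrM conjtr_int /place_form !mulmxA.
rewrite /sqnorm /place_mx !mul_col_mx !conjtr_col_mx !mul_row_col.
rewrite -!(mulmxA _ (powers _)) -!evalmx_quartic_mx ?quartic_rootN ?iw_root ?fourth_root2P //.
by rewrite [LHS]mxE; congr (_ + _); rewrite [LHS]mxE.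
Qed.

End Place.

(** Twisting multiplies the embedding matrix by a matrix of determinant +-1. *)
Lemma det_place_form g : g^T *m g = 1%:M -> \det (place_form g) = \det (place_form 1%:M).
Proof.
move=> gg; have d2 : \det g ^+ 2 = 1.
  by have := congr1 determinant gg; rewrite det_mulmx det_tr det1 expr2.
have E : place_mx g = block_mx (block_mx g 0 0 (conjmx g)) 0 0 1%:M *m place_mx 1%:M.
  rewrite /place_mx /conjmx map_mx1 !mul1mx !mul_block_col !mul0mx !mul1mx.
  by rewrite !addr0 !add0r.
have dE : \det (place_mx g) = \det g * (\det g)^* * \det (place_mx 1%:M).
  by rewrite E det_mulmx !det_ublock det1 mulr1 det_map_mx.
have conjtr_det (A : 'M[K]_N) : \det (conjtr A) = (\det A)^* by rewrite det_tr det_map_mx.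
rewrite /place_form !det_mulmx !conjtr_det dE !rmorphM /= conjCK.
move: (\det g) (\det (place_mx 1%:M)) d2 => d D d2.
transitivity (d ^+ 2 * (d^*) ^+ 2 * (D^* * D)); first by ring.
by rewrite -rmorphXn d2 rmorph1 !mul1r.
Qed.

(** For x = v^T v, the conjugates of x are bounded by the lengths of v at the
    respective places. If all were below 1, then x = 0; but at a real place x is a
    sum of squares of real numbers. *)
Lemma quartic_mx_nonzero_large g (z : 'cV[int]_N) : g^T *m g = 1%:M -> z != 0 ->
  ~ (sqnorm (g *m evalmx iw (quartic_mx z)) + sqnorm (conjmx g *m evalmx (- iw) (quartic_mx z))
     + (sqnorm (evalmx w (quartic_mx z)) + sqnorm (evalmx (- w) (quartic_mx z))) < 1).
Proof.
move=> gg z0 lt1; pose p := ((quartic_mx z)^T *m quartic_mx z) ord0 ord0.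
have pE s : peval s p = ((evalmx s (quartic_mx z))^T *m evalmx s (quartic_mx z)) ord0 ord0.
  by rewrite /evalmx map_trmx -map_mxM mxE.
have gp (h : 'M[K]_m) s : h^T *m h = 1%:M -> `|peval s p| <= sqnorm (h *m evalmx s (quartic_mx z)).
  move=> hh; apply: le_trans (dot_le _).
  by rewrite pE trmx_mul mulmxA -(mulmxA _ h^T) hh mulmx1.
have ge0 q (v : 'cV[K]_q) : 0 <= sqnorm v := conjtr_sqr_ge0 v.
have ccg : (conjmx g)^T *m conjmx g = 1%:M by rewrite map_trmx -map_mxM gg map_mx1.
have lts (h : 'M[K]_m) s : h^T *m h = 1%:M -> sqnorm (h *m evalmx s (quartic_mx z)) < 1 -> `|peval s p| < 1.
  by move=> hh h1; exact: le_lt_trans (gp _ _ hh) h1.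
have a1 : `|peval iw p| < 1.
  apply: (lts g) => //; apply: le_lt_trans lt1.
  by rewrite -addrA lerDl !addr_ge0.
have a2 : `|peval (- iw) p| < 1.
  apply: (lts (conjmx g)) => //; apply: le_lt_trans lt1.
  by rewrite [X in X + _]addrC -addrA lerDl !addr_ge0.
have a3 : `|peval w p| < 1.
  apply: (lts 1%:M); rewrite ?trmx1 ?mulmx1 // mul1mx; apply: le_lt_trans lt1.
  by rewrite addrC -addrA lerDl !addr_ge0.
have a4 : `|peval (- w) p| < 1.
  apply: (lts 1%:M); rewrite ?trmx1 ?mulmx1 // mul1mx; apply: le_lt_trans lt1.
  by rewrite addrA lerDr !addr_ge0.
have pw0 : peval w p = 0.
  apply: (pnorm_lt1 fourth_root2P fourth_root2P).
  by rewrite !mulr_ilt1 ?mulr_ge0.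
have re : conjtr (evalmx w (quartic_mx z)) = (evalmx w (quartic_mx z))^T by rewrite /conjtr evalmx_conj fourth_root2_conj.
have : sqnorm (evalmx w (quartic_mx z)) = 0 by rewrite /sqnorm re -pE.
move/conjtr_sqr_eq0/(evalmx_quartic_mx_inj fourth_root2P) => zz.
by rewrite zz eqxx in z0.
Qed.

Lemma emb_inj : injective emb. Proof. exact: fmorph_inj. Qed.

Lemma emb_lt x y : (emb x < emb y) = (x < y).
Proof. by rewrite !lt_neqAle emb_le (inj_eq emb_inj). Qed.

Lemma emb_qform (S : 'M[R]_N) (z : 'cV[int]_N) :
  emb (qform S (intmx R z)) =
  ((map_mx intr z)^T *m map_mx emb S *m map_mx intr z) ord0 ord0.
Proof.
have -> : map_mx intr z = map_mx emb (intmx R z).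
  by apply/matrixP => i j; rewrite !mxE rmorph_int.
by rewrite map_trmx -!map_mxM [RHS]mxE.
Qed.

(** The columns of a nonsingular integer matrix generate a lattice of full rank,
    so some m of the corresponding ring vectors are linearly independent. *)
Lemma powers_rank (s : K) (U : 'M[int]_N) : \det U != 0 ->
  exists f : 'I_m -> 'I_N, \det (powers s *m map_mx intr (colsub f U)) != 0.
Proof.
move=> detU; pose V : 'M[K]_N := map_mx intr U.
have Vu : V \in unitmx by rewrite unitmxE det_map_mx unitfE intr_eq0.
have full : row_full (powers s *m V)^T.
  apply/row_fullP; exists (invmx V *m col_mx (col_mx 1%:M 0) 0)^T.
  rewrite -trmx_mul mulmxA mulmxK // /powers !mul_row_col mulmx1 !mulmx0 !addr0.
  by rewrite trmx1.
exists (fullrankfun full); have := fullrowsub_unit full.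
rewrite unitmxE unitfE -det_tr; congr (\det _ != 0).
apply/matrixP => i j; rewrite !mxE; apply: eq_bigr => k _.
by rewrite !mxE.
Qed.

(** Hermite reduction for the forms [place_form g]: they share their determinant
    and their lower bound 1, so the constant does not depend on [g]. *)
Lemma bounded_integral_frame : exists2 b : K, 0 <= b &
  forall g : 'M[K]_m, g^T *m g = 1%:M ->
  exists A : 'M[int]_(N, m),
    [/\ \det (evalmx iw (quartic_mx A)) != 0, entries_le b (g *m evalmx iw (quartic_mx A)),
        entries_le b (evalmx w (quartic_mx A)) & entries_le b (evalmx (- w) (quartic_mx A))].
Proof.
have [S1 S1E] := place_form_real 1%:M.
have [B HB] := hermite_reduction N (\det S1) (ltr01 : 0 < 1 :> R).
exists (emb (1 + `|B|)); first by rewrite -(rmorph0 emb) emb_le addr_ge0.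
move=> g gg; have [S SE] := place_form_real g.
have symS : S^T = S.
  have : conjtr (place_form g) = place_form g by rewrite /place_form conjtrM conjtrK.
  rewrite /conjtr place_form_conj SE => e; apply/matrixP => i j; apply: emb_inj.
  by have := congr1 (fun M : 'M[_]_N => M i j) e; rewrite !mxE.
have detS : \det S <= \det S1.
  suff -> : \det S = \det S1 by [].
  by apply: emb_inj; rewrite -!det_map_mx -SE -S1E det_place_form.
have minS (z : 'cV[int]_N) : z != 0 -> 1 <= qform S (intmx R z).
  move=> /(quartic_mx_nonzero_large gg); rewrite -place_form_value SE -emb_qform.
  by rewrite -(rmorph1 emb) emb_lt => /negP; rewrite -leNgt.
have [U detU UB] := HB _ symS detS minS.
have [f fdet] := powers_rank iw detU.
exists (colsub f U).
have bnd (x : K) : 0 <= x -> x <= emb B -> x <= emb (1 + `|B|) ^+ 2.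
  move=> x0 xB; apply: le_trans xB _; rewrite -rmorphXn emb_le /=.
  by have := ler_norm B; have := normr_ge0 B; nra.
have colE (s : K) (h : 'M[K]_m) j : sqnorm (h *m evalmx s (quartic_mx (col (f j) U))) <= emb B ->
    forall i, `|(h *m evalmx s (quartic_mx (colsub f U))) i j| <= emb (1 + `|B|).
  move=> le i.
  have -> : (h *m evalmx s (quartic_mx (colsub f U))) i j = (h *m evalmx s (quartic_mx (col (f j) U))) i ord0.
    by rewrite !mxE; apply: eq_bigr => k _; rewrite !mxE.
  apply: entries_le_sqr; first by rewrite -(rmorph0 emb) emb_le addr_ge0.
  exact: bnd (conjtr_sqr_ge0 _) le.
have ge0 q (v : 'cV[K]_q) : 0 <= sqnorm v := conjtr_sqr_ge0 v.
have tot j : sqnorm (g *m evalmx iw (quartic_mx (col (f j) U)))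
     + sqnorm (conjmx g *m evalmx (- iw) (quartic_mx (col (f j) U)))
     + (sqnorm (evalmx w (quartic_mx (col (f j) U))) + sqnorm (evalmx (- w) (quartic_mx (col (f j) U))))
     <= emb B.
  by rewrite -place_form_value SE -emb_qform emb_le UB.
split.
- by rewrite evalmx_quartic_mx // iw_root.
- move=> i j; apply: colE; apply: le_trans (tot j).
  by rewrite -addrA lerDl !addr_ge0.
- move=> i j; rewrite -[evalmx _ _]mul1mx; apply: colE; rewrite mul1mx.
  by apply: le_trans (tot j); rewrite addrC -addrA lerDl !addr_ge0.
- move=> i j; rewrite -[evalmx _ _]mul1mx; apply: colE; rewrite mul1mx.
  by apply: le_trans (tot j); rewrite addrA lerDr !addr_ge0.
Qed.

End IntegralMatrices.

(** * The arithmetic group *)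

Section FinitelyManyInvariants.
Local Open Scope ring_scope.
Variables (T : Type) (A : set T) (I : finType) (f : T -> I -> int) (W : nat).
Hypothesis fW : forall t, A t -> forall i, `|f t i| <= W%:Z.

Let code t : {ffun I -> 'I_(W + W).+1} := [ffun i => inord (absz (f t i + W%:Z))].

Let codeP t u : A t -> A u -> code t = code u -> f t =1 f u.
Proof.
move=> At Au e i; have := congr1 (fun c : {ffun I -> 'I_(W + W).+1} => val (c i)) e.
have := fW At i; have := fW Au i; rewrite !ffunE /= => h1 h2.
by rewrite !inordK; lia.
Qed.

Lemma finite_bounded_invariants :
  (forall t u, A t -> A u -> f t =1 f u -> t = u) -> finite_set A.
Proof.
move=> inj; have [[t0 At0]|nA] := pselect (exists t, A t); last first.
  rewrite (_ : A = set0) //; apply/seteqP; split=> // t At.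
  by case: nA; exists t.
pose g c := if pselect (exists2 t, A t & code t = c) is left e then projT1 (cid2 e) else t0.
apply: (@sub_finite_set _ _ (g @` setT)); last exact/finite_image/finite_finset.
move=> t At; exists (code t) => //; rewrite /g.
case: pselect => [e|[]]; last by exists t.
by case: cid2 => u Au /= e'; apply: inj => //; exact: codeP.
Qed.

(** A bound that holds on each class of equal invariants holds uniformly, since
    there are finitely many classes. *)
Lemma uniform_over_invariants (Q : nat -> T -> Prop) :
  (forall a b t, (a <= b)%N -> Q a t -> Q b t) ->
  (forall t, A t -> exists b, forall u, A u -> f u =1 f t -> Q b u) ->
  exists b, forall t, A t -> Q b t.
Proof.
move=> mono loc.
have /choice[b bP] : forall c, exists b, forall t, A t -> code t = c -> Q b t.
  move=> c; have [[t [At tc]]|nt] := pselect (exists t, A t /\ code t = c).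
    have [b bP] := loc t At; exists b => u Au uc; apply: bP => //.
    by apply: codeP => //; rewrite uc.
  by exists 0%N => t At tc; case: nt; exists t.
exists (\max_c b c) => t At; apply: mono (bP _ t At erefl).
exact: leq_bigmax.
Qed.

End FinitelyManyInvariants.

Section ArithmeticGroup.
Local Open Scope ring_scope.
Variable K : numClosedFieldType.
Variables (n : nat) (L : 'I_n.+1 -> 'M[int]_n.+1) (w : K).
Hypotheses (LC : clifford L) (w_root : quartic_root w) (w_conj : w^* = w).
Local Notation m := n.+1.
Local Notation iw := ('i * w).
Local Notation fz := (fierz L).
Implicit Types (g h : 'M[K]_m) (X : 'M[{poly int}]_m).

Let iw_root : quartic_root iw. Proof. exact: quartic_rootMi. Qed.
Let iw_conj : iw^* = - iw. Proof. by rewrite rmorphM /= w_conj conjCi mulNr. Qed.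

Lemma quartic_root_cases s : quartic_root s ->
  [\/ s = w, s = - w, s = iw | s = - iw].
Proof.
move=> /eqP s4.
have : (s - w) * (s + w) * ((s - iw) * (s + iw)) = 0.
  rewrite -!subr_sqr exprMn sqrCi mulN1r opprK -subr_sqr -!exprM s4.
  by rewrite (eqP w_root) subrr.
move/eqP; rewrite !mulf_eq0 !subr_eq0 !addr_eq0 -orbA.
by case/or4P => /eqP; [apply: Or41|apply: Or42|apply: Or43|apply: Or44].
Qed.

(** The modulus 2m is chosen so that the traces in [Gamma_free] become smaller
    than 1. *)
Definition congruent1 X : 'M[{poly int}]_m := 1%:M + (2 * m)%:R *: X.

Lemma evalmx_congruent1 s X : evalmx s (congruent1 X) = 1%:M + (2 * m)%:R *: evalmx s X :> 'M[K]_m.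
Proof. by rewrite /evalmx /congruent1 map_mxD map_mx1 map_mxZ rmorph_nat. Qed.

Definition congruence_lift g X : Prop :=
  g = evalmx iw (congruent1 X) /\
  forall s, quartic_root s -> evalmx s (congruent1 X) *m (evalmx s (congruent1 X))^T = 1%:M :> 'M[K]_m.

(** The tensor condition is imposed at the complex place only; it singles out
    a subgroup of the orthogonal group that acts properly on the sphere. *)
Definition in_Gamma g : Prop :=
  (exists X, congruence_lift g X) /\ fz g = fz 1%:M.

Lemma fierz_mul g h : fz g = fz 1%:M -> fz h = fz 1%:M -> fz (g *m h) = fz 1%:M.
Proof. by move=> /(fierz_mulmxr h) ->; rewrite mul1mx. Qed.

Lemma fierz_inv g h : fz g = fz 1%:M -> g *m h = 1%:M -> fz h = fz 1%:M.
Proof. by move=> /(fierz_mulmxr h) + gh; rewrite gh mul1mx. Qed.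

Lemma Gamma1 : in_Gamma 1%:M.
Proof.
have e s : evalmx s (congruent1 0) = 1%:M :> 'M[K]_m.
  by rewrite evalmx_congruent1 /evalmx map_mx0 scaler0 addr0.
by split=> //; exists 0; split=> [|s _]; rewrite e // trmx1 mulmx1.
Qed.

Lemma GammaM g h : in_Gamma g -> in_Gamma h -> in_Gamma (g *m h).
Proof.
move=> [[X [gX oX]] fg] [[Y [hY oY]] fh]; split; last exact: fierz_mul.
exists (X + Y + (2 * m)%:R *: (X *m Y)).
have e s : evalmx s (congruent1 (X + Y + (2 * m)%:R *: (X *m Y))) =
    evalmx s (congruent1 X) *m evalmx s (congruent1 Y) :> 'M[K]_m.
  rewrite -[RHS]map_mxM; congr (map_mx _ _); rewrite /congruent1 mulmxDl mul1mx mulmxDr mulmx1.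
  by rewrite -scalemxAl -scalemxAr !scalerDr -!addrA; congr (_ + _); rewrite addrCA.
split=> [|s rs]; rewrite e ?gX ?hY // trmx_mul mulmxA -(mulmxA (evalmx s (congruent1 X))).
by rewrite oY // mulmx1 oX.
Qed.

Lemma Gamma_orth g : in_Gamma g -> g *m g^T = 1%:M.
Proof. by move=> [[X [-> oX]] _]; exact: oX. Qed.

Lemma GammaV g : in_Gamma g -> in_Gamma g^T.
Proof.
move=> gG; have gg := Gamma_orth gG; have [[X [gX oX]] fg] := gG.
split; last exact: fierz_inv fg gg.
have e s : evalmx s (congruent1 X^T) = (evalmx s (congruent1 X))^T :> 'M[K]_m.
  by rewrite !evalmx_congruent1 linearD linearZ /= trmx1 /evalmx map_trmx.
exists X^T; split=> [|s rs]; rewrite e ?gX // trmxK.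
exact: mulmx1C (oX _ rs).
Qed.

Lemma evalmx_real (s : K) X : s^* = s -> conjtr (evalmx s X) = (evalmx s X)^T.
Proof. by move=> sr; rewrite /conjtr evalmx_conj sr. Qed.

Lemma real_place_entries_le g X s : congruence_lift g X -> s = w \/ s = - w ->
  entries_le 1 (evalmx s (congruent1 X)).
Proof.
move=> [_ oX] sw; apply: unitary_entries_le.
have [rs sr] : quartic_root s /\ s^* = s.
  by case: sw => ->; rewrite ?rmorphN /= w_conj ?quartic_rootN.
by rewrite evalmx_real //; apply: mulmx1C; exact: oX.
Qed.

(** If [g] maps z to z', this matrix maps the real unit vector below z to the one
    below z'. *)
Definition boost_conj (z z' : 'cV[K]_m) g := boost L z' *m g *m (boost L z)^T.

Section BoostConj.
Variables (z z' : 'cV[K]_m) (g : 'M[K]_m).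
Hypotheses (zz : z^T *m z = 1%:M) (zz' : z'^T *m z' = 1%:M).
Hypotheses (gz : g *m z = z') (fg : fz g = fz 1%:M).

Lemma boost_conjK : (boost L z')^T *m boost_conj z z' g *m boost L z = g.
Proof.
rewrite /boost_conj !mulmxA (mulmx1C (boost_orth LC zz')) mul1mx.
by rewrite -mulmxA (mulmx1C (boost_orth LC zz)) mulmx1.
Qed.

Lemma boost_conj_unitary : conjtr (boost_conj z z' g) *m boost_conj z z' g = 1%:M.
Proof.
have bz := boost_orth LC zz; have cs : boost_conj z z' g *m (boost L z *m z) = boost L z' *m z'.
  rewrite /boost_conj !mulmxA -(mulmxA _ (boost L z)^T) (mulmx1C bz) mulmx1.
  by rewrite -mulmxA gz.
apply: (@fierz_unitary K n L LC (boost L z *m z)).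
- by rewrite -(boost_real LC zz) (boost_unit LC zz).
- exact: boost_real.
- by rewrite cs -(boost_real LC zz') (boost_unit LC zz').
- by rewrite cs; exact: boost_real.
have fb := fierz_boost LC zz; have fb' := fierz_boost LC zz'.
by rewrite /boost_conj !fierz_mul //; exact: fierz_inv fb bz.
Qed.

End BoostConj.

(** Up to boosts, which are bounded on bounded sets, [g] is unitary. *)
Lemma Gamma_proper (b : K) (z z' : 'cV[K]_m) g :
  z^T *m z = 1%:M -> z'^T *m z' = 1%:M -> entries_le b z -> entries_le b z' ->
  g *m z = z' -> fz g = fz 1%:M ->
  entries_le (m%:R * (m%:R * (boost_bound n b * 1) * boost_bound n b)) g.
Proof.
move=> zz zz' zb zb' gz fg; rewrite -(boost_conjK g zz zz').
apply: entries_le_mul; last exact: boost_entries_le.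
apply: entries_le_mul; first by apply: entries_le_tr; exact: boost_entries_le.
by apply: unitary_entries_le; exact: boost_conj_unitary.
Qed.

Lemma trace_le (A : 'M[K]_m) : entries_le 1 A -> `|\tr A| <= m%:R.
Proof.
move=> A1; rewrite /mxtrace (le_trans (ler_norm_sum _ _ _)) //.
apply: (@le_trans _ _ (\sum_(i < m) 1)); first by apply: ler_sum => i _; exact: A1.
by rewrite sumr_const card_ord.
Qed.

(** The ring element T = tr (X X^T), where P = 1 + 2m X, satisfies
    4 m^2 T = 2m - 2 tr P. At the complex place P is conjugate to a unitary matrix by
    a boost, and at the real places it is orthogonal, so |tr P| <= m everywhere and
    |T| <= 1/m < 1. Hence T = 0, and at a real place this forces X = 0. *)
Lemma Gamma_free (z : 'cV[K]_m) g : (0 < n)%N -> z^T *m z = 1%:M -> in_Gamma g ->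
  g *m z = z -> g = 1%:M.
Proof.
move=> n0 zz [[X lX] fg] gz; have [gX oX] := lX.
pose T := \tr (X *m X^T).
have TE s : quartic_root s ->
    (2 * m)%:R ^+ 2 * peval s T = 2 * m%:R - 2 * \tr (evalmx s (congruent1 X)) :> K.
  move=> rs; have := oX s rs; have := evalmx_congruent1 s X; move: (evalmx s (congruent1 X)) => P PE PP.
  have -> : peval s T = \tr (evalmx s X *m (evalmx s X)^T).
    by rewrite /T -trace_map_mx map_mxM -map_trmx.
  have : (2 * m)%:R *: evalmx s X = P - 1%:M by rewrite PE addrAC subrr add0r.
  move=> /(congr1 (fun M => \tr (M *m M^T))).
  rewrite linearZ /= -scalemxAl -scalemxAr scalerA linearZ /= -expr2 => ->.
  rewrite linearB /= trmx1 mulmxBl !mulmxBr PP !mulmx1 mul1mx !raddfB /= mxtrace_tr mxtrace1.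
  ring.
have m0 : 0 < (2 * m)%:R :> K by rewrite ltr0n.
have small (s : K) : quartic_root s -> `|\tr (evalmx s (congruent1 X))| <= m%:R -> `|peval s T| < 1.
  move=> rs tr_le; have : `|(2 * m)%:R ^+ 2 * peval s T| <= 4 * m%:R.
    rewrite TE // (le_trans (ler_normB _ _)) //.
    have -> : 4 * m%:R = 2 * m%:R + 2 * m%:R :> K by ring.
    by rewrite !normrM !normr_nat lerD // ler_pM2l ?ltr0n.
  rewrite normrM normrX normr_nat => le.
  rewrite -(@ltr_pM2l _ ((2 * m)%:R ^+ 2)) ?exprn_gt0 // mulr1.
  apply: le_lt_trans le _; rewrite -natrX -natrM ltr_nat.
  by case: n n0 => // k _; lia.
have tr_iw : `|\tr (evalmx iw (congruent1 X))| <= m%:R.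
  rewrite -gX -(boost_conjK g zz zz) -mulmxA mxtrace_mulC -mulmxA (boost_orth LC zz) mulmx1.
  by apply: trace_le; apply: unitary_entries_le; exact: boost_conj_unitary.
have tr_iw' : `|\tr (evalmx (- iw) (congruent1 X))| <= m%:R.
  by rewrite -iw_conj -evalmx_conj trace_map_mx norm_conjC.
have T0 : peval w T = 0.
  apply: (pnorm_lt1 w_root w_root).
  have a1 := small _ w_root (trace_le (real_place_entries_le lX (or_introl erefl))).
  have a2 := small _ (quartic_rootN w_root) (trace_le (real_place_entries_le lX (or_intror erefl))).
  have a3 := small _ iw_root tr_iw.
  have a4 := small _ (quartic_rootN iw_root) tr_iw'.
  by rewrite !mulr_ilt1 ?mulr_ge0.
have Xw i j : peval w (X i j) = 0.
  have : \sum_i \sum_j `|peval w (X i j)| ^+ 2 = 0.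
    rewrite -[RHS]T0 /T [RHS]raddf_sum; apply: eq_bigr => a _.
    rewrite mxE raddf_sum; apply: eq_bigr => c _ /=.
    by rewrite !mxE rmorphM /= normCK peval_conj w_conj.
  move=> /eqP; rewrite psumr_eq0 => [/allP/(_ i (mem_index_enum _))|a _]; last first.
    by apply: sumr_ge0 => c _; rewrite exprn_ge0.
  rewrite psumr_eq0 => [/allP/(_ j (mem_index_enum _))|c _]; last by rewrite exprn_ge0.
  by rewrite /= sqrf_eq0 normr_eq0 => /eqP.
rewrite gX evalmx_congruent1 (_ : evalmx iw X = 0) ?scaler0 ?addr0 //.
apply/matrixP => i j; rewrite !mxE.
exact: peval_pnorm_eq0 iw_root (pnorm_peval_eq0 w_root (Xw i j)).
Qed.

(** The entries of the difference are at most 2 at both real places, so closeness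
    at the complex place makes their norms smaller than 1. *)
Lemma Gamma_separated g h : in_Gamma g -> in_Gamma h ->
  (forall i j, `|g i j - h i j| < 2^-1) -> g = h.
Proof.
move=> [[X lX] _] [[Y lY] _] gh; apply/matrixP => i j; apply/eqP; rewrite -subr_eq0; apply/eqP.
pose p := congruent1 X i j - congruent1 Y i j.
have pE s : peval s p = evalmx s (congruent1 X) i j - evalmx s (congruent1 Y) i j :> K.
  by rewrite /p rmorphB !mxE.
have gp : peval iw p = g i j - h i j by rewrite pE lX.1 lY.1.
rewrite -gp; apply: (pnorm_lt1 w_root iw_root).
have le2 s : s = w \/ s = - w -> `|peval s p| <= 2.
  move=> sw; rewrite pE (le_trans (ler_normB _ _)) // -[2]/(1 + 1)%:R natrD lerD //.
    exact: real_place_entries_le lX sw _ _.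
  exact: real_place_entries_le lY sw _ _.
have lt2 : `|peval iw p| < 2^-1 by rewrite gp.
have -> : `|peval (- iw) p| = `|peval iw p| by rewrite -iw_conj -peval_conj norm_conjC.
apply: (@le_lt_trans _ _ (2 * 2 * (`|peval iw p| * `|peval iw p|))).
  by rewrite ler_pM ?mulr_ge0 ?lexx // ler_pM ?le2 //; [left|right].
have e : 2 * 2 * (2^-1 * 2^-1) = 1 :> K by field.
by rewrite -[ltRHS]e ltr_pM2l ?mulr_gt0 ?ltr0n // ltr_pM.
Qed.

Hypothesis archi : forall x : K, 0 <= x -> exists k : nat, x <= k%:R.

Lemma qcoord_nat_le p (B : K) k : 8 * B <= k%:R ->
  (forall t, quartic_root t -> `|peval t p| <= B) ->
  forall i : 'I_4, `|qcoord p i| <= k%:Z.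
Proof.
move=> Bk pB i; rewrite -(ler_int K) intr_norm.
exact: le_trans (qcoord_le w_root pB i) Bk.
Qed.

(** The entries are bounded at all places, which bounds their integer coordinates. *)
Lemma Gamma_finite (T : Type) (v : T -> 'M[K]_m) (c : K) : injective v ->
  finite_set [set t | in_Gamma (v t) /\ entries_le c (v t)].
Proof.
move=> v_inj; have [c0|c0] := pselect (0 <= c); last first.
  rewrite (_ : mkset _ = set0) //; apply/seteqP; split=> // g [_ /(_ ord0 ord0) h].
  by case: c0; apply: le_trans h.
pose lift g := if pselect (exists X, congruence_lift g X) is left e
               then projT1 (cid e) else 0.
have liftP g : in_Gamma g -> congruence_lift g (lift g).
  by move=> [e _]; rewrite /lift; case: pselect => // e'; case: cid.
have [k ck] : exists k : nat, 8 * (c + 1) <= k%:R :> K.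
  by apply: archi; rewrite mulr_ge0 ?addr_ge0.
pose f t (i : 'I_m * 'I_m * 'I_4) := qcoord (congruent1 (lift (v t)) i.1.1 i.1.2) i.2.
apply: (@finite_bounded_invariants _ _ _ f k) => [g [gG gc] i|g h [gG gc] [hG hc] fgh].
  apply: qcoord_nat_le ck _ _ => t rt; have [gX oX] := liftP _ gG.
  have pE s : peval s (congruent1 (lift (v g)) i.1.1 i.1.2) =
      evalmx s (congruent1 (lift (v g))) i.1.1 i.1.2 :> K by rewrite [RHS]mxE.
  have c1 : c <= c + 1 by rewrite lerDl.
  have c1' : 1 <= c + 1 by rewrite lerDr.
  case: (quartic_root_cases rt) => ->.
  - by rewrite pE; apply: le_trans c1'; apply: real_place_entries_le (liftP _ gG) _ _ _; left.
  - by rewrite pE; apply: le_trans c1'; apply: real_place_entries_le (liftP _ gG) _ _ _; right.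
  - by rewrite pE -gX; apply: le_trans c1.
  - rewrite -iw_conj -peval_conj norm_conjC pE -gX; exact: le_trans c1.
have [gX _] := liftP _ gG; have [hX _] := liftP _ hG.
apply: v_inj; rewrite gX hX; apply/matrixP => i j; rewrite ![evalmx _ _ _ _]mxE !peval_qcoord //.
have e k' (k4 : (k' < 4)%N) :
    qcoord (congruent1 (lift (v g)) i j) k' = qcoord (congruent1 (lift (v h)) i j) k'.
  exact: fgh (i, j, Ordinal k4).
by rewrite !e.
Qed.

(** The entries of the tensor of [X] as ring elements: at the complex place, where
    [flip] is complex conjugation, they are those of [fierz]. *)
Definition fierz_poly X a b c d : {poly int} :=
  let M k := (map_mx flip X)^T *m map_mx polyC (L k) *m X in
  \sum_k M k a b * M k c d.

Lemma peval_fierz_poly s X a b c d :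
  let M k := (evalmx (- s) X)^T *m cliff K L k *m evalmx s X in
  peval s (fierz_poly X a b c d) = \sum_k M k a b * M k c d.
Proof.
have E k i j : peval s (((map_mx flip X)^T *m map_mx polyC (L k) *m X) i j) =
    ((evalmx (- s) X)^T *m cliff K L k *m evalmx s X) i j.
  have -> : evalmx (- s) X = evalmx s (map_mx flip X).
    by apply/matrixP => u v; rewrite !mxE peval_flip.
  have -> : cliff K L k = evalmx s (map_mx polyC (L k)).
    by apply/matrixP => u v; rewrite !mxE pevalC.
  by rewrite /evalmx [(map_mx (peval s) _)^T]map_trmx -!map_mxM [RHS]mxE.
by rewrite /= rmorph_sum; apply: eq_bigr => k _; rewrite rmorphM /= !E.
Qed.

Local Notation N := (m + m + (m + m))%N.
Local Notation ix := (('I_m * 'I_m) + ('I_m * 'I_m) * ('I_m * 'I_m) + unit)%type.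

Definition invariant_poly (A : 'M[int]_(N, m)) (j : ix) : {poly int} :=
  match j with
  | inl (inl ab) => ((quartic_mx A)^T *m quartic_mx A) ab.1 ab.2
  | inl (inr abcd) => fierz_poly (quartic_mx A) abcd.1.1 abcd.1.2 abcd.2.1 abcd.2.2
  | inr _ => \det (quartic_mx A)
  end.

(** The frame found by reduction for the lattice form attached to [g]. *)
Definition good_frame (b : K) (g : 'M[K]_m) (A : 'M[int]_(N, m)) :=
  [/\ \det (evalmx iw (quartic_mx A)) != 0, entries_le b (g *m evalmx iw (quartic_mx A)),
      entries_le b (evalmx w (quartic_mx A)) & entries_le b (evalmx (- w) (quartic_mx A))].

Lemma det_le (b : K) (A : 'M[K]_m) : 0 <= b -> entries_le b A -> `|\det A| <= (m`!)%:R * b ^+ m.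
Proof.
move=> b0 Ab; rewrite /determinant (le_trans (ler_norm_sum _ _ _)) //.
apply: (@le_trans _ _ (\sum_(s : 'S_m) b ^+ m)).
  apply: ler_sum => s _; rewrite normrM normrX normrN1 expr1n mul1r normr_prod.
  apply: (@le_trans _ _ (\prod_(i < m) b)); last by rewrite prodr_const card_ord.
  by apply: ler_prod => i _; rewrite normr_ge0 Ab.
by rewrite sumr_const card_Sn mulr_natl.
Qed.

(** At the complex place the invariants of a frame agree, up to a sign for the
    determinant, with those of its image under [g], whose entries are bounded. *)
Lemma invariant_poly_le (b : K) : 0 <= b -> exists B : K, 0 <= B /\
  forall g A, g^T *m g = 1%:M -> fz g = fz 1%:M -> good_frame b g A ->
  forall j s, quartic_root s -> `|peval s (invariant_poly A j)| <= B.
Proof.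
move=> b0; pose c := m%:R * (m%:R * (b * 1) * b).
have c0 : 0 <= c by rewrite !mulr_ge0.
exists (m%:R * (b * b) + m%:R * (c * c) + (m`!)%:R * b ^+ m); split.
  by rewrite !addr_ge0 ?mulr_ge0 ?exprn_ge0 ?ler0n.
move=> g A gg fg [_ Aiw Aw Aw'] j s rs.
set X := quartic_mx A in Aiw Aw Aw' *.
have real_place t : quartic_root t -> t^* = t ->
    entries_le b (evalmx t X) -> entries_le b (evalmx (- t) X) ->
    `|peval t (invariant_poly A j)| <= m%:R * (b * b) + m%:R * (c * c) + (m`!)%:R * b ^+ m.
  move=> rt tr tb tb'; case: j => [[[a d]|[[a d] [a' d']]]|[]] /=.
  - have -> : peval t ((X^T *m X) a d) = ((evalmx t X)^T *m evalmx t X) a d.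
      by rewrite /evalmx map_trmx -map_mxM [RHS]mxE.
    rewrite -addrA; apply: ler_wpDr; first by rewrite addr_ge0 ?mulr_ge0 ?exprn_ge0 ?ler0n.
    exact: entries_le_mul (entries_le_tr tb) tb _ _.
  - rewrite peval_fierz_poly.
    rewrite addrAC; apply: ler_wpDl; first by rewrite addr_ge0 ?mulr_ge0 ?exprn_ge0 ?ler0n.
    rewrite (le_trans (ler_norm_sum _ _ _)) // mulr_natl.
    apply: (@le_trans _ _ (\sum_(k < m) c * c)); last by rewrite sumr_const card_ord.
    have Mc k : entries_le c ((evalmx (- t) X)^T *m cliff K L k *m evalmx t X).
      exact: entries_le_mul (entries_le_mul (entries_le_tr tb') (cliff_entries_le K LC k)) tb.
    by apply: ler_sum => k _; rewrite normrM ler_pM //; exact: Mc.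
  - have -> : peval t (\det X) = \det (evalmx t X) by rewrite /evalmx det_map_mx.
    apply: ler_wpDl; first by rewrite addr_ge0 ?mulr_ge0 ?exprn_ge0 ?ler0n.
    exact: det_le.
have complex_place : `|peval iw (invariant_poly A j)| <=
    m%:R * (b * b) + m%:R * (c * c) + (m`!)%:R * b ^+ m.
  case: j {real_place} => [[[a d]|[[a d] [a' d']]]|[]] /=.
  - have -> : peval iw ((X^T *m X) a d) = ((g *m evalmx iw X)^T *m (g *m evalmx iw X)) a d.
      rewrite trmx_mul mulmxA -(mulmxA _ g^T) gg mulmx1.
      by rewrite /evalmx map_trmx -map_mxM [RHS]mxE.
    rewrite -addrA; apply: ler_wpDr; first by rewrite addr_ge0 ?mulr_ge0 ?exprn_ge0 ?ler0n.
    exact: entries_le_mul (entries_le_tr Aiw) Aiw _ _.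
  - have -> : peval iw (fierz_poly X a d a' d') =
        fz (g *m evalmx iw X) (mxvec_index a d) (mxvec_index a' d').
      rewrite (fierz_mulmxr _ fg) mul1mx peval_fierz_poly fierzE.
      by rewrite /conjtr evalmx_conj iw_conj.
    rewrite fierzE addrAC; apply: ler_wpDl; first by rewrite addr_ge0 ?mulr_ge0 ?exprn_ge0 ?ler0n.
    rewrite (le_trans (ler_norm_sum _ _ _)) // mulr_natl.
    apply: (@le_trans _ _ (\sum_(k < m) c * c)); last by rewrite sumr_const card_ord.
    have Mc k : entries_le c (conjtr (g *m evalmx iw X) *m cliff K L k *m (g *m evalmx iw X)).
      exact: entries_le_mul (entries_le_mul (entries_le_ctr Aiw) (cliff_entries_le K LC k)) Aiw.
    by apply: ler_sum => k _; rewrite normrM ler_pM //; exact: Mc.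
  - have -> : `|peval iw (\det X)| = `|\det (g *m evalmx iw X)|.
      rewrite det_mulmx /evalmx det_map_mx normrM -[LHS]mul1r; congr (_ * _).
      have := congr1 determinant gg; rewrite det_mulmx det_tr det1 -expr2 => d2.
      by apply/eqP; rewrite eq_sym -(@eqrXn2 _ 2) // -normrX d2 normr1 expr1n.
    apply: ler_wpDl; first by rewrite addr_ge0 ?mulr_ge0 ?exprn_ge0 ?ler0n.
    exact: det_le.
case: (quartic_root_cases rs) => ->.
- exact: real_place.
- by apply: real_place; rewrite ?quartic_rootN ?rmorphN /= ?w_conj ?opprK.
- exact: complex_place.
- by rewrite -iw_conj -peval_conj norm_conjC.
Qed.

(** Write g = X0 X^-1 = 1 + (X0 - X) X^-1. The inverse of X has the norm N of det X as
    its denominator, and X0 - X is divisible by 2m N, so g is integral and congruent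
    to 1. Equal Gram matrices make it orthogonal and equal tensors make it preserve
    the tensor. *)
Lemma congruent_frames (A A0 Z : 'M[int]_(N, m)) (e : int) :
  \det (evalmx iw (quartic_mx A)) != 0 ->
  A0 = A + ((2 * m)%:R * (e * pnorm (\det (quartic_mx A)))) *: Z ->
  (forall j s, quartic_root s ->
     peval s (invariant_poly A j) = peval s (invariant_poly A0 j) :> K) ->
  let g := evalmx iw (quartic_mx A0) *m invmx (evalmx iw (quartic_mx A)) in in_Gamma g /\ \det g = 1.
Proof.
set X := quartic_mx A; set d := \det X => detX A0E inv g.
have pd s : peval s d = \det (evalmx s X) :> K by rewrite /evalmx det_map_mx.
have dn0 (s : K) : quartic_root s -> peval s d != 0 :> K.
  move=> rs; apply: contraNneq detX => d0.
  by rewrite -pd (peval_pnorm_eq0 iw_root) // (pnorm_peval_eq0 rs).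
pose Y := (e%:P * cofactor d) *: (quartic_mx Z *m \adj X).
have PX s : quartic_root s -> evalmx s (congruent1 Y) *m evalmx s X = evalmx s (quartic_mx A0) :> 'M[K]_m.
  move=> rs; rewrite evalmx_congruent1 mulmxDl mul1mx.
  have -> : evalmx s Y = ((e%:~R : K) * peval s (cofactor d)) *: (evalmx s (quartic_mx Z) *m \adj (evalmx s X)).
    by rewrite /evalmx map_mxZ map_mxM map_mx_adj rmorphM /= pevalC.
  rewrite -!scalemxAl -mulmxA mul_adj_mx -pd mul_mx_scalar !scalerA.
  rewrite A0E !evalmx_quartic_mx // map_mxD map_mxZ mulmxDr -scalemxAr; congr (_ + _ *: _).
  rewrite -[RHS]/(((2 * m)%:R * (e * pnorm d))%:~R) !intrM rmorph_nat -(cofactorE _ rs).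
  by ring.
have gram s : quartic_root s -> (evalmx s (quartic_mx A0))^T *m evalmx s (quartic_mx A0) = (evalmx s X)^T *m evalmx s X :> 'M[K]_m.
  move=> rs; apply/matrixP => a c.
  have := inv (inl (inl (a, c))) s rs; rewrite /= => h.
  by move: h; rewrite /evalmx ![(map_mx _ _)^T]map_trmx -!map_mxM ![map_mx _ _ _ _]mxE.
have Xu (s : K) : quartic_root s -> evalmx s X \in unitmx.
  by move=> rs; rewrite unitmxE -pd unitfE dn0.
have orth s : quartic_root s -> evalmx s (congruent1 Y) *m (evalmx s (congruent1 Y))^T = 1%:M :> 'M[K]_m.
  move=> rs; apply: mulmx1C; apply: (can_inj (mulmxK (Xu s rs))).
  have Xtu : (evalmx s X)^T \in unitmx by rewrite unitmx_tr Xu.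
  apply: (can_inj (mulKmx Xtu)).
  by rewrite mul1mx -gram // -PX // trmx_mul !mulmxA.
have gE : g = evalmx iw (congruent1 Y) by rewrite /g -PX // mulmxK // Xu.
split; last first.
  have e0 : \det (evalmx iw (quartic_mx A0)) = \det (evalmx iw X).
    by rewrite /evalmx !det_map_mx; exact: esym (inv (inr tt) iw iw_root).
  by rewrite /g det_mulmx det_inv e0 divff.
split; first by exists Y.
have fX : fz (evalmx iw (quartic_mx A0)) = fz (evalmx iw X).
  apply: fierzP => a c a' c'; rewrite !fierzE.
  have := inv (inl (inr ((a, c), (a', c')))) _ iw_root.
  by rewrite /= !peval_fierz_poly /conjtr !evalmx_conj iw_conj.
by rewrite /g (fierz_mulmxr _ fX) mulmxV // Xu.
Qed.

Hypothesis frames : exists2 b : K, 0 <= b &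
  forall g : 'M[K]_m, g^T *m g = 1%:M -> exists A, good_frame b g A.

(** The invariants of the frame of z are finitely many bounded integers. For z in the
    class of z0, the element g = X0 X^-1 satisfies X0^T g z = X^T z by orthogonality,
    and X^T z is the product of the transposed bounded frame with a real unit vector.
    So g z is bounded in terms of X0. *)
Lemma Gamma_cocompact : exists k : nat, forall z : 'cV[K]_m, z^T *m z = 1%:M ->
  exists g, [/\ in_Gamma g, \det g = 1 & entries_le k%:R (g *m z)].
Proof.
have [b b0 fr] := frames; have [B [B0 invB]] := invariant_poly_le b0.
have [M0 M0B] := archi (exprn_ge0 4 B0).
(* The norm of the determinant of a frame varies, but it divides M0!. *)
pose modulus : int := ((2 * m)%:R * (M0`!)%:Z).
have mod0 : 0 < modulus by rewrite mulr_gt0 ?ltr0n // ltz_nat fact_gt0.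
have [W1 W1B] : exists k : nat, 8 * B <= k%:R :> K by apply: archi; rewrite mulr_ge0.
pose S : set ('cV[K]_m * 'M[int]_(N, m)) :=
  [set zA | zA.1^T *m zA.1 = 1%:M /\ good_frame b (boost L zA.1) zA.2]%classic.
pose f (zA : 'cV[K]_m * 'M[int]_(N, m)) (i : (ix * 'I_4) + ('I_N * 'I_m)) : int :=
  match i with
  | inl jk => qcoord (invariant_poly zA.2 jk.1) jk.2
  | inr ab => (zA.2 ab.1 ab.2 %% modulus)%Z
  end.
have bB zA : S zA -> forall j s, quartic_root s -> `|peval s (invariant_poly zA.2 j)| <= B.
  move=> [zz good] j s rs; apply: (invB (boost L zA.1)) => //.
    exact: mulmx1C (boost_orth LC zz).
  exact: fierz_boost.
have fW zA : S zA -> forall i, `|f zA i| <= (W1 + `|modulus|)%N%:Z.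
  move=> SzA [[j k]|[i j]] /=.
    apply: le_trans (qcoord_nat_le W1B (bB zA SzA j) k) _.
    by rewrite lez_nat leq_addr.
  rewrite ger0_norm ?modz_ge0 ?gt_eqF //.
  apply: le_trans (ltW (ltz_pmod _ mod0)) _.
  by rewrite PoszD -[leLHS]add0r lerD // ler_norm.
pose Q (k : nat) (zA : 'cV[K]_m * 'M[int]_(N, m)) :=
  exists g, [/\ in_Gamma g, \det g = 1 & entries_le k%:R (g *m zA.1)].
have [k kP] : exists k, forall zA, S zA -> Q k zA.
  apply: (uniform_over_invariants fW) => [a c zA ac [g [gG dg ga]]|[z0 A0] [zz0 good0]].
    by exists g; split=> //; apply: entries_le_trans ga; rewrite ler_nat.
  have [detX0 _ _ _] := good0.
  pose X0 := evalmx iw (quartic_mx A0).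
  have X0u : X0^T \in unitmx by rewrite unitmx_tr unitmxE unitfE.
  pose x0 : K := \sum_i \sum_j `|invmx X0^T i j|.
  have x0P : entries_le x0 (invmx X0^T).
    move=> i j; rewrite /x0 (bigD1 i) //= (bigD1 j) //= -addrA lerDl addr_ge0 //.
      by apply: sumr_ge0 => *.
    by apply: sumr_ge0 => ? _; apply: sumr_ge0 => *.
  have x00 : 0 <= x0 by apply: sumr_ge0 => ? _; apply: sumr_ge0 => *.
  have [k kb] : exists k : nat, m%:R * (x0 * (m%:R * (b * 1))) <= k%:R.
    by apply: archi; rewrite !mulr_ge0.
  exists k => -[z A] [/= zz good] fe; have [detX Aiw _ _] := good.
  have inv j s : quartic_root s ->
      peval s (invariant_poly A j) = peval s (invariant_poly A0 j) :> K.
    move=> rs; rewrite !peval_qcoord //.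
    have e k' (k4 : (k' < 4)%N) : qcoord (invariant_poly A j) k' = qcoord (invariant_poly A0 j) k'.
      exact: fe (inl (j, Ordinal k4)).
    by rewrite !e.
  pose D := pnorm (\det (quartic_mx A)).
  have D0 : D != 0.
    apply: contraNneq detX => /(peval_pnorm_eq0 iw_root) d0.
    by rewrite /evalmx det_map_mx; apply/eqP.
  have DM : (`|D| <= M0)%N.
    rewrite -lez_nat -(ler_int K) abszE intr_norm (pnormE _ w_root) !normrM.
    apply: le_trans M0B; have dB s rs := bB (z, A) (conj zz good) (inr tt) s rs.
    have -> : B ^+ 4 = B * B * (B * B) by ring.
    by rewrite !ler_pM ?mulr_ge0 // dB ?quartic_rootN // ?iw_root.
  have /dvdnP[e' eE] : (`|D| %| M0`!)%N by rewrite dvdn_fact // absz_gt0 D0.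
  pose e : int := e'%:Z * sgz D.
  have eD : e * D = (M0`!)%:Z.
    by rewrite /e -mulrA -abszEsg eE PoszM.
  pose Z : 'M[int]_(N, m) := \matrix_(i, j) ((A0 i j - A i j) %/ modulus)%Z.
  have A0E : A0 = A + ((2 * m)%:R * (e * D)) *: Z.
    rewrite eD -/modulus; apply/matrixP => i j; rewrite !mxE mulrC divzK.
      by rewrite addrC subrK.
    by rewrite -eqz_mod_dvd; apply/eqP; exact: esym (fe (inr (i, j))).
  have [gG dg] := congruent_frames detX A0E inv.
  move: gG dg; set g := _ *m _ => gG dg.
  exists g; split=> //; apply: entries_le_trans kb _.
  have gX : g *m evalmx iw (quartic_mx A) = X0.
    by rewrite /g mulmxKV // unitmxE unitfE.
  clearbody g.
  have gzE : X0^T *m (g *m z) = (boost L z *m evalmx iw (quartic_mx A))^T *m (boost L z *m z).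
    rewrite -gX !trmx_mul -!mulmxA (mulmxA g^T) (mulmx1C (Gamma_orth gG)) mul1mx.
    by rewrite (mulmxA (boost L z)^T) (mulmx1C (boost_orth LC zz)) mul1mx.
  rewrite -[g *m z](mulKmx X0u) gzE.
  apply: entries_le_mul x0P _; apply: entries_le_mul; first exact: entries_le_tr.
  by apply: unitary_entries_le; exact: boost_unit.
exists k => z zz; have [A good] := fr _ (mulmx1C (boost_orth LC zz)).
exact: kP (z, A) (conj zz good).
Qed.

End ArithmeticGroup.

(** * Topology of SO(m) and of the orbit map to the sphere *)

Section CompactSO.
Local Open Scope ring_scope.
Local Open Scope classical_set_scope.
Variables (K : numClosedFieldType) (R : realType) (emb : {rmorphism R -> K}).
Hypothesis emb_le : {mono emb : x y / x <= y}.
Hypothesis emb_real : forall x : K, x \is Num.real -> exists r, x = emb r.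

Lemma emb_norm r : `|emb r| = emb `|r|.
Proof.
have [r0|/ltW r0] := leP 0 r.
  by rewrite (ger0_norm r0) ger0_norm // -[0](rmorph0 emb) emb_le.
by rewrite (ler0_norm r0) rmorphN ler0_norm // -[0](rmorph0 emb) emb_le.
Qed.

Lemma emb_continuous : continuous (emb : R -> K).
Proof.
move=> r; apply/cvgrPdist_lt => e e0.
have [e' eE] := emb_real (gtr0_real e0).
have e'0 : 0 < e' by rewrite -(emb_lt emb_le) rmorph0 -eE.
have /cvgrPdist_lt/(_ e' e'0) : (fun x : R => x) @ r --> r by exact: cvg_id.
by apply: filterS => t; rewrite eE -rmorphB emb_norm emb_lt.
Qed.

(** A compact set that contains the disk of radius k. *)
Definition square (k : R) : set K :=
  [set emb p.1 + 'i * emb p.2 | p in `[- k, k] `*` `[- k, k]].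

Lemma square_compact k : compact (square k).
Proof.
apply: continuous_compact; last exact: compact_setX (@segment_compact _ _ _) (@segment_compact _ _ _).
apply: continuous_subspaceT => p; apply: cvgD.
  apply: (@continuous_comp _ _ _ fst (emb : R -> K)); first exact: cvg_fst.
  exact: emb_continuous.
apply: cvgM; first exact: cvg_cst.
apply: (@continuous_comp _ _ _ snd (emb : R -> K)); first exact: cvg_snd.
exact: emb_continuous.
Qed.

Lemma square_norm (k : R) (x : K) : `|x| <= emb k -> square k x.
Proof.
move=> xk; have [a aE] := emb_real (Creal_Re x); have [b bE] := emb_real (Creal_Im x).
have k0 : 0 <= k by rewrite -emb_le rmorph0 (le_trans _ xk).
have : emb (a ^+ 2 + b ^+ 2) <= emb (k ^+ 2).
  rewrite rmorphD !rmorphXn /= -aE -bE -normC2_Re_Im.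
  by rewrite lerXn2r ?nnegrE ?normr_ge0 // (le_trans _ xk).
rewrite emb_le => abk.
exists (a, b); last by rewrite /= -aE -bE -Crect.
by split; rewrite /= in_itv /=; apply/andP; split; nra.
Qed.

Lemma matrix_square_compact (k : R) m :
  compact [set A : 'M[K]_m | forall i j, square k (A i j)].
Proof.
have -> : [set A : 'M[K]_m | forall i j, square k (A i j)] =
    vec_mx @` [set v : 'rV[K]_(m * m) | forall i, square k (v ord0 i)].
  apply/seteqP; split=> [A Ak|_ [v vk <-] i j /=]; last by rewrite mxE; exact: vk.
  exists (mxvec A); last exact: mxvecK.
  by move=> i; case/mxvec_indexP: i => i j; rewrite mxvecE; exact: Ak.
apply: continuous_compact; last 
  by apply: (@rV_compact K _ (fun=> square k)) => _; exact: square_compact.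
apply: continuous_subspaceT; apply: continuous_mx => i j v.
rewrite (_ : (fun x => _) = fun u : 'rV[K]_(m * m) => u ord0 (mxvec_index i j)).
  exact: coord_mx_continuous.
by apply/funext => u; rewrite mxE.
Qed.

Lemma SO_matrix_closed m : closed [set A : 'M[K]_m | A *m A^T = 1%:M /\ \det A = 1].
Proof.
have clE (f : 'M[K]_m -> K) c : continuous f -> closed [set A | f A = c].
  move=> fc; apply: (@preimage_closed _ _ f [set c]); first by move=> A _; exact: fc.
  exact/accessible_closed_set1/hausdorff_accessible/norm_hausdorff.
rewrite (_ : mkset _ = (\bigcap_ij [set A : 'M[K]_m | (A *m A^T) ij.1 ij.2 = (ij.1 == ij.2)%:R])
   `&` [set A | \det A = 1]).
  apply: closedI.
    apply: closed_bigI => -[i j] _; apply: clE.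
    rewrite (_ : (fun x => _) = fun B : 'M[K]_m => \sum_k B i k * B j k); last first.
      by apply/funext => B; rewrite mxE; apply: eq_bigr => k _; rewrite mxE.
    move=> A; apply: (@cvg_big K _ _ _ _ (@add_continuous K) _ (nbhs A)) => k _.
    by apply: cvgM; exact: coord_mx_continuous.
  apply: clE => A; apply: (@cvg_big K _ _ _ _ (@add_continuous K) _ (nbhs A)) => s _.
  apply: cvgM; first exact: cvg_cst.
  apply: (@cvg_big K _ _ _ _ (@mul_continuous K) _ (nbhs A)) => k _.
  exact: coord_mx_continuous.
apply/seteqP; split=> A /= [AA dA]; split=> //.
  by move=> [i j] _ /=; rewrite AA mxE.
by apply/matrixP => i j; rewrite (AA (i, j) I) mxE.
Qed.

(** SO(m) carries the topology induced by the matrix entries. *)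
Lemma nbhs_SO m (g : SO K m) (V : set (SO K m)) : nbhs g V ->
  exists2 W : set 'M[K]_m, nbhs (SO_val g) W & (@SO_val K m) @^-1` W `<=` V.
Proof.
rewrite nbhsE => -[U [[W oW WU] Ug] UV]; exists W; last by rewrite /SO_val WU.
by apply: open_nbhs_nbhs; split=> //; rewrite -WU in Ug.
Qed.

Lemma compact_SO m (k : R) :
  compact [set g : SO K m | forall i j, square k (SO_val g i j)].
Proof.
move=> F PF FB.
have FA : F ((@SO_val K m) @^-1` ([set A : 'M[K]_m | forall i j, square k (A i j)] `&`
    [set A | A *m A^T = 1%:M /\ \det A = 1])).
  apply: (@filterS _ F _ _ _ _ FB) => g gk; split=> //.
  by split; [exact: SO_trmxr|exact: SO_det].
have [A [[Ak Aorth] clA]] :=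
  compact_closedI (@matrix_square_compact k m) (@SO_matrix_closed m)
    (fmap_proper_filter (@SO_val K m) PF) FA.
exists (exist _ A (mem_set Aorth)); split; first exact: Ak.
move=> U V FU /nbhs_SO[W AW WV].
have FS : F ((@SO_val K m) @^-1` [set SO_val u | u in U]).
  by apply: (@filterS _ F _ _ _ _ FU) => u Uu; exists u.
have [B [[u Uu <-] Wu]] := clA _ W FS AW.
by exists u; split=> //; exact: WV.
Qed.

End CompactSO.

Section SphereOrbits.
Local Open Scope ring_scope.
Local Open Scope classical_set_scope.
Local Open Scope quotient_scope.
Variables (K : numClosedFieldType) (n : nat).
Local Notation m := n.+1.
Local Notation G := (SO K m).
Local Notation H := (SO_sub K n).
Local Notation X := (homogeneous_space H).
Local Notation e0 := (delta_mx ord0 ord0 : 'cV[K]_m).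

(** The orbit of the base point e_0, whose stabilizer is H; it identifies G / H with
    the complex sphere. *)
Definition base_orbit (g : G) : 'cV[K]_m := SO_val g *m e0.

Lemma base_orbitM g h : base_orbit (g * h)%g = SO_val g *m base_orbit h.
Proof. by rewrite /base_orbit mulmxA. Qed.

Lemma base_orbit_eq (g h : G) :
  (g^-1 * h)%g \in H <-> base_orbit g = base_orbit h.
Proof.
have val_mul : SO_val (g^-1 * h)%g = (SO_val g)^T *m SO_val h by [].
split=> [/SO_subE gh|e].
  have : (SO_val g)^T *m base_orbit h = e0.
    rewrite /base_orbit mulmxA -val_mul -colE; apply/matrixP => i j.
    by rewrite (ord1 j) mxE; have [_ ->] := gh i; rewrite mxE andbT.
  by move=> /(congr1 (mulmx (SO_val g))); rewrite mulmxA SO_trmxr mul1mx.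
have ce : SO_val (g^-1 * h)%g *m e0 = e0.
  by rewrite val_mul -mulmxA -/(base_orbit h) -e /base_orbit mulmxA SO_trmxl mul1mx.
have re : (SO_val (g^-1 * h)%g)^T *m e0 = e0.
  by rewrite -[in LHS]ce mulmxA SO_trmxl mul1mx.
apply/SO_subE => i; split.
  have := congr1 (fun v : 'cV_m => v i ord0) re.
  by rewrite -colE !mxE andbT eq_sym.
have := congr1 (fun v : 'cV_m => v i ord0) ce.
by rewrite -colE !mxE andbT.
Qed.

Definition sphere_point (x : X) : 'cV[K]_m := base_orbit (repr x).

Lemma sphere_point_pi (g : G) : sphere_point (\pi_(X) g) = base_orbit g.
Proof.
rewrite /sphere_point; apply/base_orbit_eq.
by apply/coset_eqP; rewrite reprK.
Qed.

Lemma sphere_point_translate g x : sphere_point (translate g x) = SO_val g *m sphere_point x.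
Proof. by rewrite -[x]reprK translateE !sphere_point_pi base_orbitM. Qed.

Lemma sphere_point_unit x : (sphere_point x)^T *m sphere_point x = 1%:M.
Proof.
rewrite /sphere_point /base_orbit trmx_mul mulmxA -(mulmxA _ _^T) SO_trmxl mulmx1.
apply/matrixP => i j; rewrite !ord1 mxE (bigD1 ord0) //= big1 => [|k /negPf k0].
  by rewrite !mxE !eqxx mulr1 addr0.
by rewrite !mxE k0 mulr0.
Qed.

Lemma sphere_point_continuous : continuous sphere_point.
Proof.
apply: (@repr_comp_continuous _ _ _ base_orbit).
  apply: continuous_mx => i j g.
  rewrite (_ : (fun x => _) = fun h : G => SO_val h i ord0); last first.
    by apply/funext => h; rewrite /base_orbit -colE mxE.
  exact: SO_coord_continuous.
by move=> g h /eqP/coset_eqP/base_orbit_eq ->.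
Qed.

Lemma compact_entries_le (C : set 'cV[K]_m) : (forall x : K, exists k : nat, `|x| < k%:R) ->
  compact C -> exists k : nat, forall v, C v -> entries_le k%:R v.
Proof.
move=> archi; rewrite compact_cover => cC.
pose U (k : nat) := [set v : 'cV[K]_m | forall i, `|v i ord0| < k%:R].
have Uopen k : [set: nat] k -> open (U k).
  move=> _; rewrite openE => v Uv.
  apply: (@filter_forall _ _ (fun i (u : 'cV[K]_m) => `|u i ord0| < k%:R) (nbhs v)) => i.
  exact: (cvgr_norm_lt (v i ord0) (@coord_mx_continuous K m 1 i ord0 v) _ (Uv i)).
have [v Cv|D _ CD] := cC nat setT U Uopen.
  have /choice[b bP] := fun i => archi (v i ord0).
  exists (\max_i b i)%N => //= i; apply: lt_le_trans (bP i) _.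
  by rewrite ler_nat leq_bigmax.
exists (\max_(k <- finmap.enum_fset D) k)%N => v /CD[k kD Uk] i j; rewrite (ord1 j) ltW //.
apply: lt_le_trans (Uk i) _; rewrite ler_nat.
exact: (@leq_bigmax_seq _ (finmap.enum_fset D) xpredT id).
Qed.

Lemma compact_sphere_bounded (S : set X) : (forall x : K, exists k : nat, `|x| < k%:R) ->
  compact S -> exists k : nat, forall x, S x -> entries_le k%:R (sphere_point x).
Proof.
move=> archi cS; have [|k kP] := @compact_entries_le [set sphere_point x | x in S] archi.
  apply: continuous_compact cS; apply: continuous_subspaceT.
  exact: sphere_point_continuous.
by exists k => x Sx; apply: kP; exists x.
Qed.

End SphereOrbits.

(** * Compact Clifford-Klein forms *)

Section CliffordKleinForm.
Local Open Scope ring_scope.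
Local Open Scope classical_set_scope.
Local Open Scope quotient_scope.
Variables (K : numClosedFieldType) (R : realType) (emb : {rmorphism R -> K}).
Hypothesis emb_le : {mono emb : x y / x <= y}.
Hypothesis emb_real : forall x : K, x \is Num.real -> exists r, x = emb r.
Variables (n : nat) (L : 'I_n.+1 -> 'M[int]_n.+1).
Hypotheses (LC : clifford L) (n_gt0 : (0 < n)%N).
Local Notation m := n.+1.
Local Notation G := (SO K m).
Local Notation H := (SO_sub K n).
Local Notation X := (homogeneous_space H).
Local Notation w := (fourth_root2 emb).

Let w4 : quartic_root w := fourth_root2P emb.
Let wr : w^* = w := fourth_root2_conj emb_le.

Lemma archi_ge0 (x : K) : 0 <= x -> exists k : nat, x <= k%:R.
Proof.
move=> x0; have [r rE] := emb_real (ger0_real x0); exists (Num.bound r).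
rewrite rE -(rmorph_nat emb) emb_le ltW //.
by apply: archi_boundP; rewrite -emb_le rmorph0 -rE.
Qed.

Lemma archi_norm (x : K) : exists k : nat, `|x| < k%:R.
Proof.
have [k xk] := archi_ge0 (normr_ge0 x); exists k.+1.
by apply: le_lt_trans xk _; rewrite ltr_nat.
Qed.

(** The orthonormal frame of z is an orthogonal matrix with first column z; the sign
    of its last column is adjusted to make the determinant 1. *)
Lemma sphere_lift (b : K) (z : 'cV[K]_m) : z^T *m z = 1%:M -> entries_le b z ->
  exists2 h : G, base_orbit h = z & entries_le (m%:R * b) (SO_val h).
Proof.
move=> zz zb; pose F := frame L z; have FF := frame_orth LC zz; rewrite -/F in FF.
have d2 : \det F * \det F = 1.
  by have := congr1 determinant FF; rewrite det_mulmx det_tr det1.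
pose e := \row_(j < m) (if j == ord_max then \det F else 1).
have ee : diag_mx e *m (diag_mx e)^T = 1%:M.
  rewrite tr_diag_mx mulmx_diag -diag_const_mx; congr diag_mx.
  by apply/rowP => j; rewrite !mxE; case: eqP => _; rewrite ?d2 ?mulr1.
have orth : (F *m diag_mx e) *m (F *m diag_mx e)^T = 1%:M.
  by rewrite trmx_mul mulmxA -(mulmxA F) ee mulmx1 (mulmx1C FF).
have det1 : \det (F *m diag_mx e) = 1.
  rewrite det_mulmx det_diag (bigD1 ord_max) //= big1 ?mulr1 => [|j /negPf jm].
    by rewrite mxE eqxx.
  by rewrite mxE jm.
exists (exist _ (F *m diag_mx e) (mem_set (conj orth det1))).
  rewrite /base_orbit [SO_val _]/(F *m diag_mx e) -mulmxA -colE.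
  rewrite (_ : col ord0 _ = delta_mx ord0 ord0) ?frame_ord0 //.
  apply/matrixP => i j; rewrite !mxE (ord1 j) andbT.
  have [->|//] := eqVneq i ord0; rewrite ?mulr1n ?mulr0n //.
  by rewrite -val_eqE /= eq_sym (gtn_eqF n_gt0).
move=> i j.
have hE : (F *m diag_mx e) i j = F i j * e ord0 j by rewrite mul_mx_diag mxE.
rewrite [SO_val _ _ _]hE normrM (_ : `|e ord0 j| = 1) ?mulr1.
  exact: (frame_entries_le LC zb i j).
rewrite mxE; case: eqP => _; last by rewrite normr1.
by apply/eqP; rewrite -(@eqrXn2 _ 2) // expr1n expr2 -normrM d2 normr1.
Qed.

Definition Gamma : {pred G} := fun g => `[< in_Gamma L w (SO_val g) >].

Lemma GammaP (g : G) : reflect (in_Gamma L w (SO_val g)) (g \in Gamma).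
Proof. exact: asboolP. Qed.

Fact Gamma_mul_closed : {in Gamma &, forall g h, (g * h)%g \in Gamma}.
Proof. by move=> g h /GammaP gG /GammaP hG; apply/GammaP; exact: GammaM. Qed.

Fact Gamma_one : 1%g \in Gamma.
Proof. by apply/GammaP; exact: Gamma1. Qed.

Fact Gamma_inv_closed : {in Gamma, forall g, g^-1%g \in Gamma}.
Proof. by move=> g /GammaP gG; apply/GammaP; exact: GammaV. Qed.

Definition Gamma_group : groupClosed G := HB.pack Gamma
  (isMulClosed.Build _ Gamma Gamma_mul_closed)
  (isMul1Closed.Build _ Gamma Gamma_one)
  (isInvClosed.Build _ Gamma Gamma_inv_closed).

Lemma Gamma_discrete : discrete_subgroup Gamma_group.
Proof.
move=> g gG; split; first exact: mem_set.
exists [set h : G | forall i j, `|SO_val g i j - SO_val h i j| < 2^-1].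
  apply: (@filter_forall _ _ (fun i (h : G) => forall j, `|SO_val g i j - SO_val h i j| < 2^-1) (nbhs g)) => i.
  apply: (@filter_forall _ _ (fun j (h : G) => `|SO_val g i j - SO_val h i j| < 2^-1) (nbhs g)) => j.
  have := @SO_coord_continuous K m i j g.
  by move=> /cvgrPdist_lt; apply; rewrite invr_gt0 ltr0n.
apply/seteqP; split=> [h [gh hG]|_ ->]; last first.
  by split=> //= i j; rewrite subrr normr0 invr_gt0 ltr0n.
apply: SO_val_inj; apply/esym.
exact: (Gamma_separated w4 wr (GammaP _ gG) (GammaP _ hG) gh).
Qed.

Lemma Gamma_properly_discontinuous : properly_discontinuous H Gamma_group.
Proof.
move=> S cS; have [k kS] := compact_sphere_bounded archi_norm cS.
pose c : K := m%:R * (m%:R * (boost_bound n k%:R * 1) * boost_bound n k%:R).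
apply: (@sub_finite_set _ _ [set g : G | in_Gamma L w (SO_val g) /\ entries_le c (SO_val g)]).
  move=> g [/GammaP gG [_ [[x Sx <-] Sgx]]]; split=> //.
  apply: (Gamma_proper LC (sphere_point_unit x) (sphere_point_unit (translate g x))).
  - exact: kS.
  - exact: kS.
  - by rewrite sphere_point_translate.
  - by case: gG.
apply: (Gamma_finite L w4 wr archi_ge0); exact: SO_val_inj.
Qed.

Lemma Gamma_acts_freely : acts_freely H Gamma_group.
Proof.
move=> g x /GammaP gG gx; apply: SO_val_inj.
apply: (Gamma_free LC w4 wr n_gt0 (sphere_point_unit x) gG).
by rewrite -sphere_point_translate gx.
Qed.

(** By cocompactness each orbit meets a bounded part of the sphere, and bounded
    points lift to a bounded, hence compact, subset of SO(m). *)
Lemma Gamma_quotient_compact : compact [set: clifford_klein_space H Gamma_group].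
Proof.
have [|k kP] := Gamma_cocompact LC w4 wr archi_ge0.
  exact: bounded_integral_frame emb_le emb_real.
pose b : R := m%:R * k%:R.
pose C := [set g : G | forall i j, square emb b (SO_val g i j)].
have cC : compact C by exact: compact_SO.
have cX : compact [set \pi_(X) g | g in C].
  apply: continuous_compact cC; apply: continuous_subspaceT; exact: pi_continuous.
suff -> : [set: clifford_klein_space H Gamma_group] =
    [set \pi_(clifford_klein_space H Gamma_group) x | x in [set \pi_(X) g | g in C]].
  apply: continuous_compact cX; apply: continuous_subspaceT; exact: pi_continuous.
apply/seteqP; split=> // y _; set x := repr y.
have [A [gG dA Ab]] := kP _ (sphere_point_unit x).
pose g : G := exist _ A (mem_set (conj (Gamma_orth w4 gG) dA)).
have zz : (sphere_point (translate g x))^T *m sphere_point (translate g x) = 1%:M.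
  exact: sphere_point_unit.
have zb : entries_le k%:R (sphere_point (translate g x)).
  by rewrite sphere_point_translate.
have [h hz hb] := sphere_lift zz zb.
exists (\pi_(X) h).
  exists h => // i j; apply: square_norm => //.
  by rewrite /b rmorphM !rmorph_nat; exact: hb.
have -> : \pi_(X) h = translate g x.
  rewrite -[RHS]reprK; apply/coset_eqP/base_orbit_eq.
  exact: hz.
rewrite -[y]reprK -/x; apply/esym.
apply/(@eqquotP _ (orbit_equiv H Gamma_group) (clifford_klein_space H Gamma_group)).
by apply/asboolP; exists g => //; apply/GammaP.
Qed.

Theorem clifford_compact_form : admits_compact_clifford_klein_form H.
Proof.
exists Gamma_group; split.
- exact: Gamma_discrete.
- exact: Gamma_properly_discontinuous.
- exact: Gamma_acts_freely.
- exact: Gamma_quotient_compact.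
Qed.

End CliffordKleinForm.

Theorem theorem2p4p1 (R : realType) (n : nat) :
  n = 1 \/ n = 3 \/ n = 7 ->
  admits_compact_clifford_klein_form (SO_sub R[i] n).
Proof.
move=> n137; have [L LC] := exists_clifford n137.
have n_gt0 : (0 < n)%N by case: n137 => [->|[->|->]].
apply: (@clifford_compact_form _ R (real_complex R) _ _ n L LC n_gt0).
  exact: lecR.
by move=> x /complex_realP.
Qed.
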